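(* Let $k$ be a field and let $L$ be a simple Lie algebra over $k$. Assume that for some Galois extension $k'/k$ with $k'\neq\mathbb F_2$, the Lie algebra $L_{k'}:=L\otimes_k k'$ is simple, is generated by its pure extremal elements, and its extremal geometry contains lines. Let $x,y\in L$ be extremal elements of $L$ forming a hyperbolic pair, scaled so that $g(x,y)=1$, and let $L=L_{-2}\oplus L_{-1}\oplus L_0\oplus L_1\oplus L_2$ be the associated $5$-grading. Then $L$ is algebraic with respect to this grading, i.e. for every $l\in L_1$ there exists an $l$-exponential automorphism of $L$.
   Context: Let $M$ be a Lie algebra over a field $F$. A nonzero $x\in M$ is extremal if there is a map $g_x\colon M\to F$ such that for all $u,w\in M$: $[x,[x,u]]=2g_x(u)x$, $[[x,u],[x,w]]=g_x([u,w])x+g_x(w)[x,u]-g_x(u)[x,w]$ and $[x,[u,[x,w]]]=g_x([u,w])x-g_x(w)[x,u]-g_x(u)[x,w]$. An element $x$ is a sandwich if $[x,[x,u]]=0$ and $[x,[u,[x,w]]]=0$ for all $u,w$ (for sandwiches one takes $g_x=0$); an extremal element is pure if it is not a sandwich. If $M$ is generated by its pure extremal elements, there is a unique symmetric bilinear form $g$ on $M$ with $g(x,u)=g_x(u)$ for all extremal $x$ and all $u$; it satisfies $g([a,b],c)=g(a,[b,c])$. Two pure extremal elements $x,u$ with $Fx\neq Fu$ are collinear if $[x,u]=0$ and $\lambda x+\mu u$ is extremal or $0$ for all $\lambda,\mu\in F$; they are hyperbolic if $g(x,u)\neq 0$. The extremal geometry has as points the lines $Fx$ ($x$ extremal) and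 as lines the $2$-spaces spanned by collinear pairs; it ''contains lines'' if a collinear pair exists. Here $g$ denotes the form of $L_{k'}$; extremal elements of $L$ are extremal in $L_{k'}$, and $g$ takes values in $k$ on $L\times L$ for such elements. The $5$-grading associated with $x,y$ (with $g(x,y)=1$): put $N_L(x)=\{l\in L:[x,l]\in kx\}$, $U=\{u\in L: g(u,x)=g(u,y)=g(u,[x,y])=0\}$, and $L_{-2}=kx$, $L_{-1}=[x,U]$, $L_0=N_L(x)\cap N_L(y)$, $L_1=[y,U]$, $L_2=ky$; this is a $\mathbb Z$-grading $L=\bigoplus_{i=-2}^{2}L_i$, and we set $L_i=0$ for $|i|>2$. For $l\in L_1$, an automorphism $\alpha$ of $L$ is called $l$-exponential if there exist maps $q_\alpha,n_\alpha,v_\alpha\colon L\to L$ with $q_\alpha(L_i)\subseteq L_{i+2}$, $n_\alpha(L_i)\subseteq L_{i+3}$, $v_\alpha(L_i)\subseteq L_{i+4}$ for all $i\in[-2,2]$ such that $\alpha(m)=m+[l,m]+q_\alpha(m)+n_\alpha(m)+v_\alpha(m)$ for all $m\in L$. *)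

(* Defs.v *)
From HB Require Import structures.
From mathcomp Require Import all_boot all_order all_algebra.
Set Implicit Arguments. Unset Strict Implicit. Unset Printing Implicit Defensive.
Import Order.TTheory GRing.Theory Num.Theory.
Local Open Scope ring_scope.

Section LieDefs.
Variables (R : fieldType) (V : lmodType R) (br : V -> V -> V).

Definition lie_algebra : Prop :=
  [/\ forall (a : R) (u v w : V), br (a *: u + v) w = a *: br u w + br v w,
      forall (a : R) (u v w : V), br w (a *: u + v) = a *: br w u + br w v,
      forall u : V, br u u = 0 &
      forall u v w : V, br u (br v w) + br v (br w u) + br w (br u v) = 0].

Definition lie_ideal (I : V -> Prop) : Prop :=
  [/\ I 0, (forall u v, I u -> I v -> I (u + v)),
      (forall (a : R) u, I u -> I (a *: u)) &
      (forall u v, I v -> I (br u v))].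

Definition lie_subalgebra (S : V -> Prop) : Prop :=
  [/\ S 0, (forall u v, S u -> S v -> S (u + v)),
      (forall (a : R) u, S u -> S (a *: u)) &
      (forall u v, S u -> S v -> S (br u v))].

Definition simple_lie : Prop :=
  (exists u v, br u v != 0) /\
  forall I, lie_ideal I -> (forall v, I v -> v = 0) \/ (forall v, I v).

Definition extremal_with (gx : V -> R) (x : V) : Prop :=
  x != 0 /\
  forall u w : V,
  [/\ br x (br x u) = (gx u *+ 2) *: x,
      br (br x u) (br x w) = gx (br u w) *: x + gx w *: br x u - gx u *: br x w &
      br x (br u (br x w)) = gx (br u w) *: x - gx w *: br x u - gx u *: br x w].

Definition extremal (x : V) : Prop := exists gx : V -> R, extremal_with gx x.

Definition sandwich (x : V) : Prop :=
  forall u w : V, br x (br x u) = 0 /\ br x (br u (br x w)) = 0.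

Definition pure_extremal (x : V) : Prop := extremal x /\ ~ sandwich x.

Definition generated_by_pure_extremal : Prop :=
  forall S, lie_subalgebra S -> (forall x, pure_extremal x -> S x) ->
  forall v, S v.

(* Fx <> Fu for nonzero x, u *)
Definition distinct_points (x u : V) : Prop := ~ exists c : R, u = c *: x.

Definition collinear (x u : V) : Prop :=
  [/\ pure_extremal x, pure_extremal u, distinct_points x u, br x u = 0 &
      forall l m : R, extremal (l *: x + m *: u) \/ l *: x + m *: u = 0].

Definition contains_lines : Prop := exists x u, collinear x u.

Definition extremal_form (g : V -> V -> R) : Prop :=
  [/\ forall u v, g u v = g v u,
      forall (a : R) u v w, g (a *: u + v) w = a * g u w + g v w,
      forall a b c, g (br a b) c = g a (br b c),
      forall x, extremal x -> extremal_with (g x) x &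
      forall x, sandwich x -> forall u, g x u = 0].

Definition hyperbolic_pair (F : fieldType) (g : V -> V -> F) (x u : V) : Prop :=
  [/\ pure_extremal x, pure_extremal u, distinct_points x u & g x u != 0].

(* The 5-grading associated with x, y; g is the form restricted to L *)
Definition normalizer (x l : V) : Prop := exists c : R, br x l = c *: x.

Definition U_space (F : fieldType) (g : V -> V -> F) (x y u : V) : Prop :=
  [/\ g u x = 0, g u y = 0 & g u (br x y) = 0].

Definition grade (F : fieldType) (g : V -> V -> F) (x y : V) (i : int) (m : V) : Prop :=
  match i with
  | Negz 1 => exists c : R, m = c *: x
  | Negz 0 => exists u, U_space g x y u /\ m = br x u
  | Posz 0 => normalizer x m /\ normalizer y m
  | Posz 1 => exists u, U_space g x y u /\ m = br y u
  | Posz 2 => exists c : R, m = c *: y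
  | _ => m = 0
  end.

Definition lie_automorphism (al : V -> V) : Prop :=
  [/\ forall (a : R) u v, al (a *: u + v) = a *: al u + al v,
      bijective al &
      forall u v, al (br u v) = br (al u) (al v)].

Definition l_exponential (F : fieldType) (g : V -> V -> F) (x y : V) (l : V) (al : V -> V) : Prop :=
  lie_automorphism al /\
  exists q n v : V -> V,
  [/\ forall (i : int) m, (-2 <= i <= 2)%R -> grade g x y i m ->
         grade g x y (i + 2) (q m),
      forall (i : int) m, (-2 <= i <= 2)%R -> grade g x y i m ->
         grade g x y (i + 3) (n m),
      forall (i : int) m, (-2 <= i <= 2)%R -> grade g x y i m ->
         grade g x y (i + 4) (v m) &
      forall m, al m = m + br l m + q m + n m + v m].

Definition algebraic_grading (F : fieldType) (g : V -> V -> F) (x y : V) : Prop :=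
  forall l, grade g x y 1 l -> exists al, l_exponential g x y l al.

End LieDefs.

(* Galois extension k'/k given by the embedding s : k -> k' : algebraic, and the
   fixed field of Aut(k'/k) is exactly k (Artin; covers infinite extensions). *)
Definition galois_ext (k k' : fieldType) (s : {rmorphism k -> k'}) : Prop :=
  (forall a : k', exists p : {poly k}, p != 0 /\ root (map_poly s p) a) /\
  (forall a : k',
     (forall t : {rmorphism k' -> k'}, bijective t -> (forall c, t (s c) = s c) ->
        t a = a) -> exists c : k, a = s c).

Definition not_F2 (k' : fieldType) : Prop := exists a : k', a != 0 /\ a != 1.

(* (M, brM, iota) is the scalar extension L (x)_k k' : iota is a k-linear Lie
   homomorphism, iota(L) spans M over k', and sum c_i iota(l_i) = 0 with the c_i
   k-linearly independent forces all l_i = 0. This characterizes L (x)_k k'. *)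
Definition scalar_extension (k k' : fieldType) (s : {rmorphism k -> k'})
  (L : lmodType k) (brL : L -> L -> L) (M : lmodType k') (brM : M -> M -> M)
  (iota : L -> M) : Prop :=
  [/\ forall (a : k) u v, iota (a *: u + v) = s a *: iota u + iota v,
      forall u v, iota (brL u v) = brM (iota u) (iota v),
      forall m : M, exists t : seq (k' * L), m = \sum_(p <- t) p.1 *: iota p.2 &
      forall (n : nat) (c : 'I_n -> k') (l : 'I_n -> L),
        (forall a : 'I_n -> k, \sum_i s (a i) * c i = 0 -> forall i, a i = 0) ->
        \sum_i c i *: iota (l i) = 0 -> forall i, l i = 0].

(* Main.v *)
(* Over [k'], an extremal element [f] of [L_1] has the exponential
   [m |-> m + [f, m] + g(f, m) f], and products of exponentials are exponential for
   the sum. So the first point is that [L_1] is spanned by extremal elements. Let [S] be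
   their span and [W] the subspace of elements whose components of degree [1] and [-1] lie
   in [S] and in its mirror image and whose component of degree [0] normalizes both.
   The torus of a hyperbolic pair (this needs a scalar other than 0 and 1) shows that [W]
   is a subalgebra; the orbit of [y] under the isometries preserving [W] is closed
   under collinearity, hence contains every extremal element, and [W] is everything.

   For the descent, an [l]-exponential automorphism can fail to be unique up to
   [exp(L_2)] in characteristic 2 and 3, so uniqueness cannot be used. Instead, an element of
   trace 1 (Dedekind) writes [l] in [L] as the sum of a Galois-stable finite family of extremal
   elements of [L_1]. The product of their exponentials depends on the order of the factors
   only up to [exp(c y)], as [[L_1, L_1]] lies in [k' y]; prescribing one coefficient fixes
   [c], and the resulting automorphism commutes with the Galois group. *)
Require Import Defs.
From HB Require Import structures.
From mathcomp Require Import all_boot all_order all_algebra.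
From mathcomp Require Import ring zify.
From mathcomp Require Import boolp.
Set Implicit Arguments. Unset Strict Implicit. Unset Printing Implicit Defensive.
Import Order.TTheory GRing.Theory.
Local Open Scope ring_scope.

(** Characteristic 2 shapes the argument. There [br x (br x u)] vanishes, so the first extremal
    identity does not determine [g], and [g (br x y) (br x y) = -2] vanishes too. Everything is
    therefore drawn from the two other identities, from the form, and from degrees: the lowest
    component of an extremal element is again extremal, and exponentials supply extremal elements
    with a wanted lowest component.

    Lines enter through one special pair: two orthogonal extremal elements that do not commute. The
    isometry group is transitive on points, so every point then has neighbours, and a neighbour can
    slide along its line until it is orthogonal to a given element. This links the orbit of [y] to
    extremal elements not yet known to lie in [W]. An element that the orbit failed to reach would
    commute with the span of the orbit, which is a nonzero ideal, and so would be central.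

    Descent needs [g] to be Galois-equivariant, hence [g x] to be determined by [x]; in
    characteristic 2 this too comes from a neighbour. *)

(* The square-zero extension of [R] by [V] is a commutative ring, so that [ring] can
   prove linear identities in [V]. *)
Definition sqz (R : fieldType) (V : lmodType R) : Type := (R * V)%type.
HB.instance Definition _ R V := GRing.Zmodule.on (@sqz R V).

Section Sqz.
Variables (R : fieldType) (V : lmodType R).
Definition sqz_mul (p q : sqz V) : sqz V := (p.1 * q.1, p.1 *: q.2 + q.1 *: p.2).
Definition sqz_one : sqz V := (1, 0).
Fact sqz_mulA : associative sqz_mul.
Proof.
move=> [a u] [b v] [c w]; congr pair => /=; first exact: mulrA.
by rewrite !scalerDr !scalerA addrA (mulrC c a) (mulrC c b).
Qed.
Fact sqz_mulC : commutative sqz_mul.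
Proof. by move=> [a u] [b v]; congr pair => /=; rewrite (mulrC, addrC). Qed.
Fact sqz_mul1 : left_id sqz_one sqz_mul.
Proof. by move=> [a u]; congr pair => /=; rewrite ?mul1r // scale1r scaler0 addr0. Qed.
Fact sqz_mulDl : left_distributive sqz_mul +%R.
Proof.
move=> [a u] [b v] [c w]; congr pair => /=; first exact: mulrDl.
by rewrite scalerDl scalerDr addrACA.
Qed.
Fact sqz_one_neq0 : sqz_one != 0 :> sqz V.
Proof. by apply/eqP => -[/eqP]; rewrite oner_eq0. Qed.
HB.instance Definition _ := GRing.Zmodule_isComNzRing.Build (sqz V)
  sqz_mulA sqz_mulC sqz_mul1 sqz_mulDl sqz_one_neq0.

Definition sqz_vec (v : V) : sqz V := (0, v).
Definition sqz_sc (a : R) : sqz V := (a, 0).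
Fact sqz_sc_additive : zmod_morphism sqz_sc.
Proof. by move=> a b; congr pair; rewrite /= subr0. Qed.
HB.instance Definition _ := GRing.isZmodMorphism.Build R (sqz V) sqz_sc sqz_sc_additive.
Fact sqz_sc_mult : monoid_morphism sqz_sc.
Proof. by split=> // a b; congr pair; rewrite /= !scaler0 addr0. Qed.
HB.instance Definition _ := GRing.isMonoidMorphism.Build R (sqz V) sqz_sc sqz_sc_mult.
Lemma sqz_vecD u v : sqz_vec (u + v) = sqz_vec u + sqz_vec v.
Proof. by congr pair; rewrite /= addr0. Qed.
Lemma sqz_vecN v : sqz_vec (- v) = - sqz_vec v.
Proof. by congr pair; rewrite /= oppr0. Qed.
Lemma sqz_vec0 : sqz_vec 0 = 0. Proof. by []. Qed.
Lemma sqz_vecMn v n : sqz_vec (v *+ n) = sqz_vec v *+ n.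
Proof. by elim: n => // n IH; rewrite !mulrSr sqz_vecD IH. Qed.
Lemma sqz_vecZ a v : sqz_vec (a *: v) = sqz_sc a * sqz_vec v.
Proof. by congr pair; rewrite /= ?mulr0 // scaler0 addr0. Qed.
Lemma sqz_vec_inj : injective sqz_vec. Proof. by move=> u v []. Qed.
End Sqz.


Definition sqz_vecE := (sqz_vecD, sqz_vecN, sqz_vec0, sqz_vecMn, sqz_vecZ).
Ltac lmodring := apply: sqz_vec_inj; rewrite ?sqz_vecE; ring.

Lemma eq_by_diff (W : zmodType) (a b u v : W) : a = b -> u - v = a - b -> u = v.
Proof. by move=> -> /eqP; rewrite subrr subr_eq0 => /eqP. Qed.

(** * Lie algebras with an associative form *)

Section LieForm.
Variables (R : fieldType) (V : lmodType R) (br : V -> V -> V) (g : V -> V -> R).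

Definition invariant_form : Prop :=
  [/\ forall u v, g u v = g v u,
      forall (a : R) u v w, g (a *: u + v) w = a * g u w + g v w &
      forall a b c, g (br a b) c = g a (br b c)].

(* Unlike [extremal_with], this allows [z = 0]. *)
Definition ext (z : V) : Prop := forall u w : V,
  [/\ br z (br z u) = (g z u *+ 2) *: z,
      br (br z u) (br z w) = g z (br u w) *: z + g z w *: br z u - g z u *: br z w &
      br z (br u (br z w)) = g z (br u w) *: z - g z w *: br z u - g z u *: br z w].

Definition isom (th : V -> V) : Prop :=
  [/\ forall (a : R) u v, th (a *: u + v) = a *: th u + th v, bijective th,
      forall u v, th (br u v) = br (th u) (th v) &
      forall u v, g (th u) (th v) = g u v].

Hypothesis lieP : lie_algebra br.
Hypothesis formP : invariant_form.
Hypothesis center0 : forall z, (forall u, br z u = 0) -> z = 0.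

Lemma br_linl a u v w : br (a *: u + v) w = a *: br u w + br v w.
Proof. by case: lieP. Qed.
Lemma br_linr a u v w : br w (a *: u + v) = a *: br w u + br w v.
Proof. by case: lieP. Qed.
Lemma brvv u : br u u = 0. Proof. by case: lieP. Qed.
Lemma brDl u v w : br (u + v) w = br u w + br v w.
Proof. by have := br_linl 1 u v w; rewrite !scale1r. Qed.
Lemma brDr u v w : br w (u + v) = br w u + br w v.
Proof. by have := br_linr 1 u v w; rewrite !scale1r. Qed.
Lemma br0l w : br 0 w = 0.
Proof. by have /(congr1 (fun z => z - br 0 w)) := brDl 0 0 w; rewrite addr0 addrK subrr. Qed.
Lemma br0r w : br w 0 = 0.
Proof. by have /(congr1 (fun z => z - br w 0)) := brDr 0 0 w; rewrite addr0 addrK subrr. Qed.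
Lemma brZl a u w : br (a *: u) w = a *: br u w.
Proof. by have := br_linl a u 0 w; rewrite br0l !addr0. Qed.
Lemma brZr a u w : br w (a *: u) = a *: br w u.
Proof. by have := br_linr a u 0 w; rewrite br0r !addr0. Qed.
Lemma brNl u w : br (- u) w = - br u w.
Proof. by rewrite -scaleN1r brZl scaleN1r. Qed.
Lemma brNr u w : br w (- u) = - br w u.
Proof. by rewrite -scaleN1r brZr scaleN1r. Qed.
Definition brE := (brDl, brDr, brNl, brNr, brZl, brZr, br0l, br0r, brvv).
Lemma brC u v : br u v = - br v u.
Proof.
have := brvv (u + v); rewrite brDl !brDr !brvv add0r addr0 => /eqP.
by rewrite addr_eq0 => /eqP.
Qed.
Lemma brJ u v w : br u (br v w) = br (br u v) w + br v (br u w).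
Proof.
case: lieP => _ _ _ /(_ u v w) J; rewrite (brC (br u v)) (brC u w) !brE.
by apply/eqP; rewrite -subr_eq0 -{}J; apply/eqP; lmodring.
Qed.

Lemma gC u v : g u v = g v u. Proof. by case: formP. Qed.
Lemma gDl u v w : g (u + v) w = g u w + g v w.
Proof. by case: formP => _ /(_ 1 u v w) + _; rewrite scale1r mul1r. Qed.
Lemma g0l w : g 0 w = 0.
Proof. by have /(congr1 (fun z => z - g 0 w)) := gDl 0 0 w; rewrite addr0 addrK subrr. Qed.
Lemma gZl a u w : g (a *: u) w = a * g u w.
Proof. by case: formP => _ /(_ a u 0 w) + _; rewrite addr0 g0l addr0. Qed.
Lemma gNl u w : g (- u) w = - g u w.
Proof. by rewrite -scaleN1r gZl mulN1r. Qed.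
Lemma gDr u v w : g w (u + v) = g w u + g w v.
Proof. by rewrite !(gC w) gDl. Qed.
Lemma gZr a u w : g w (a *: u) = a * g w u.
Proof. by rewrite !(gC w) gZl. Qed.
Lemma gNr u w : g w (- u) = - g w u.
Proof. by rewrite !(gC w) gNl. Qed.
Lemma g0r w : g w 0 = 0. Proof. by rewrite gC g0l. Qed.
Definition gE := (gDl, gDr, gNl, gNr, gZl, gZr, g0l, g0r).
Lemma gA a b c : g (br a b) c = g a (br b c). Proof. by case: formP. Qed.
Lemma gad u v w : g (br u v) w = - g v (br u w).
Proof. by rewrite brC gNl gA. Qed.

Lemma ext1 z u : ext z -> br z (br z u) = (g z u *+ 2) *: z.
Proof. by move=> /(_ u u) []. Qed.
Lemma ext2 z u w : ext z ->
  br (br z u) (br z w) = g z (br u w) *: z + g z w *: br z u - g z u *: br z w.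
Proof. by move=> /(_ u w) []. Qed.
Lemma ext3 z u w : ext z ->
  br z (br u (br z w)) = g z (br u w) *: z - g z w *: br z u - g z u *: br z w.
Proof. by move=> /(_ u w) []. Qed.

Lemma extZ a z : ext z -> ext (a *: z).
Proof.
move=> Ez u w; split; rewrite !brE !gE.
- by rewrite ext1 //; lmodring.
- by rewrite ext2 //; lmodring.
- by rewrite ext3 //; lmodring.
Qed.
Lemma ext0 : ext 0.
Proof. by move=> u w; rewrite !br0l !g0l; split; lmodring. Qed.

Lemma gzb z u : g z (br z u) = 0. Proof. by rewrite -gA brvv g0l. Qed.

(** If [g z z] were nonzero, the third identity with [u = z] would make [z] central. *)
Lemma ext_gzz z : ext z -> g z z = 0.
Proof.
move=> Ez; have [//|zn0] := eqVneq (g z z) 0.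
rewrite [z]center0 ?g0l // => w; have := ext3 z w Ez.
rewrite ext1 // brvv gzb => eq0; have {eq0} : g z z *: br z w = 0.
  by apply/oppr_inj; rewrite oppr0 -[RHS](scale0r z) -[0 in RHS](mul0rn _ 2) eq0; lmodring.
by move/eqP; rewrite scaler_eq0 (negPf zn0) => /eqP.
Qed.

(** The last term is a divided square: twice [g z m *: z] is [br z (br z m)]. *)
Definition expz (z m : V) : V := m + br z m + g z m *: z.

Lemma expz_lin z a u v : expz z (a *: u + v) = a *: expz z u + expz z v.
Proof. by rewrite /expz !brE !gE; lmodring. Qed.

Lemma expz_br z u w : ext z -> expz z (br u w) = br (expz z u) (expz z w).
Proof.
move=> Ez; rewrite /expz !brE (ext1 _ Ez) (ext2 _ _ Ez).
rewrite (brC (br z u) z) (ext1 _ Ez) (brJ z u w) (brC u z).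
by lmodring.
Qed.

Lemma expzK z : ext z -> cancel (expz z) (expz (- z)).
Proof.
move=> Ez m; rewrite /expz !brE !gE (ext1 _ Ez) (ext_gzz Ez) gzb.
by lmodring.
Qed.

Lemma expz_g z u w : ext z -> g (expz z u) (expz z w) = g u w.
Proof.
move=> Ez; rewrite /expz !gE (ext_gzz Ez) gzb (gC (br z u) z) gzb.
by rewrite !gad (ext1 _ Ez) !gE (gC u z); ring.
Qed.

Lemma extN z : ext z -> ext (- z).
Proof. by rewrite -scaleN1r; apply: extZ. Qed.

Lemma expz_isom z : ext z -> isom (expz z).
Proof.
move=> Ez; split.
- exact: expz_lin.
- exists (expz (- z)); first exact: expzK.
  by have := expzK (extN Ez); rewrite opprK.
- by move=> *; apply: expz_br.
- by move=> *; apply: expz_g.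
Qed.

Lemma isom_comp th1 th2 : isom th1 -> isom th2 -> isom (th1 \o th2).
Proof.
move=> [l1 b1 h1 g1] [l2 b2 h2 g2]; split => [a u v||u v|u v] /=.
- by rewrite l2 l1.
- exact: bij_comp.
- by rewrite h2 h1.
- by rewrite g1 g2.
Qed.

Lemma isom_inv th th' : isom th -> cancel th th' -> cancel th' th -> isom th'.
Proof.
move=> [l b h gg] c c'; split => [a u v||u v|u v].
- by apply: (can_inj c); rewrite l !c'.
- by exists th.
- by apply: (can_inj c); rewrite h !c'.
- by rewrite -gg !c'.
Qed.

Section IsomLinear.
Variables (th : V -> V) (I : isom th).
Lemma isomD u v : th (u + v) = th u + th v.
Proof. by case: I => l _ _ _; have := l 1 u v; rewrite !scale1r. Qed.
Lemma isom0 : th 0 = 0.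
Proof. by have /(congr1 (fun z => z - th 0)) := isomD 0 0; rewrite addr0 addrK subrr. Qed.
Lemma isomZ a u : th (a *: u) = a *: th u.
Proof. by case: I => l _ _ _; have := l a u 0; rewrite isom0 !addr0. Qed.
Lemma isomN u : th (- u) = - th u.
Proof. by rewrite -scaleN1r isomZ scaleN1r. Qed.
End IsomLinear.
Definition isomE th (I : isom th) := (isomD I, isom0 I, isomZ I, isomN I).

Lemma isom_ext th z : isom th -> ext z -> ext (th z).
Proof.
move=> I Ez; have [_ [th' c c'] h gg] := I.
move=> u w; rewrite -(c' u) -(c' w) -!h !gg; split.
- by rewrite ext1 // (isomE I).
- by rewrite ext2 // !(isomE I).
- by rewrite ext3 // !(isomE I).
Qed.

(** * The 5-grading of a hyperbolic pair *)

(** On degree -1 the map [- br x (br y m)] is the identity, and it kills positive degrees. The two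
    corrections cancel what it does to degree 0 (a multiple of [br x y]) and to degree -2
    (multiplication by 2). *)
Definition pdn (x y m : V) : V :=
  - br x (br y m) + g (br x y) m *: br x y - (g y m *+ 2) *: x.

(* The projection onto degree [i] of the 5-grading of the pair [x, y]; unlike the
   eigenspaces of [br x y], these formulas work in every characteristic. *)
Definition pr_def (x y : V) (i : int) (m : V) : V :=
  match i with
  | Negz 1 => g y m *: x
  | Negz 0 => pdn x y m
  | Posz 0 => m - g y m *: x - pdn x y m - pdn y x m - g x m *: y
  | Posz 1 => pdn y x m
  | Posz 2 => g x m *: y
  | _ => 0
  end.
Definition pr := locked pr_def.

Lemma prT : pr = pr_def. Proof. by rewrite /pr -lock. Qed.

Lemma pr_swap x y i m : pr y x i m = pr x y (- i) m.
Proof. by rewrite prT; case: i => [[|[|[|n]]]|[|[|n]]] //=; lmodring. Qed.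

Lemma U_swap x y u : U_space br g x y u -> U_space br g y x u.
Proof. by case=> a b c; split; rewrite // brC gNr c oppr0. Qed.

Lemma grade_swap x y i m : grade br g x y i m -> grade br g y x (- i) m.
Proof.
case: i => [[|[|[|n]]]|[|[|n]]] //=; first by case.
- by case=> u [/U_swap ? ->]; exists u.
- by case=> u [/U_swap ? ->]; exists u.
Qed.

Lemma gr_lin x y i a u v : grade br g x y i u -> grade br g x y i v ->
  grade br g x y i (a *: u + v).
Proof.
have UL w w' : U_space br g x y w -> U_space br g x y w' -> U_space br g x y (a *: w + w').
  by move=> [p q r] [p' q' r']; split; rewrite !gE ?p ?q ?r ?p' ?q' ?r' mulr0 addr0.
case: i => [[|[|[|n]]]|[|[|n]]] /=.
- move=> [[c Hc] [d Hd]] [[c' Hc'] [d' Hd']]; split.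
    by exists (a * c + c'); rewrite !brE Hc Hc'; lmodring.
  by exists (a * d + d'); rewrite !brE Hd Hd'; lmodring.
- by move=> [w [W ->]] [w' [W' ->]]; exists (a *: w + w'); rewrite br_linr; split=> //; apply: UL.
- by move=> [c ->] [c' ->]; exists (a * c + c'); lmodring.
- by move=> -> ->; rewrite scaler0 addr0.
- by move=> [w [W ->]] [w' [W' ->]]; exists (a *: w + w'); rewrite br_linr; split=> //; apply: UL.
- by move=> [c ->] [c' ->]; exists (a * c + c'); lmodring.
- by move=> -> ->; rewrite scaler0 addr0.
Qed.

Lemma gr0 x y i : grade br g x y i 0.
Proof.
have U0 : U_space br g x y 0 by split; rewrite g0l.
case: i => [[|[|[|n]]]|[|[|n]]] //=; try by [exists 0; rewrite br0r|exists 0; rewrite scale0r].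
by split; exists 0; rewrite br0r scale0r.
Qed.
Lemma grD x y i u v : grade br g x y i u -> grade br g x y i v -> grade br g x y i (u + v).
Proof. by move=> Gu Gv; rewrite -[u]scale1r; apply: gr_lin. Qed.
Lemma grZ x y i a u : grade br g x y i u -> grade br g x y i (a *: u).
Proof. by move=> Gu; rewrite -[_ *: u]addr0; apply: gr_lin => //; apply: gr0. Qed.
Lemma grN x y i u : grade br g x y i u -> grade br g x y i (- u).
Proof. by rewrite -scaleN1r; apply: grZ. Qed.

Lemma pr_lin x y i a u v : pr x y i (a *: u + v) = a *: pr x y i u + pr x y i v.
Proof.
by rewrite prT; case: i => [[|[|[|n]]]|[|[|n]]] //=; rewrite /pdn ?brE ?gE; lmodring.
Qed.

Lemma pr_sum x y m :
  m = pr x y (-2) m + pr x y (-1) m + pr x y 0 m + pr x y 1 m + pr x y 2 m.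
Proof. by rewrite prT /=; lmodring. Qed.

Section FrameHalf.
Variables x y : V.
Hypotheses (Ex : ext x) (Ey : ext y) (gxy : g x y = 1).
Local Notation h := (br x y).
Let hE : h = - br y x. Proof. exact: brC. Qed.
Let gyx : g y x = 1. Proof. by rewrite gC. Qed.
Let gxx : g x x = 0. Proof. exact: ext_gzz. Qed.
Let gyy : g y y = 0. Proof. exact: ext_gzz. Qed.

Lemma br_xh : br x h = 2 *: x.
Proof. by rewrite ext1 // gxy; lmodring. Qed.
Lemma br_yh : br y h = - (2 *: y).
Proof. by rewrite hE brNr ext1 // gyx; lmodring. Qed.
Lemma g_xh : g x h = 0. Proof. exact: gzb. Qed.
Lemma g_yh : g y h = 0. Proof. by rewrite hE gNr gzb oppr0. Qed.
Lemma g_hh : g h h = - 2.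
Proof. by rewrite {1}gA br_yh gNr gZr gxy mulr1. Qed.
Lemma g_hm m : g h m = g x (br y m). Proof. exact: gA. Qed.
Lemma g_hm' m : g h m = - g y (br x m). Proof. exact: gad. Qed.

Lemma g_h_br_y m : g h (br y m) = 2 * g y m.
Proof. by rewrite g_hm ext1 // gZr gxy mulr1 mulr_natl. Qed.

Lemma br_xyx m : br x (br y (br x m)) = g h m *: x - g x m *: h - br x m.
Proof. by rewrite ext3 // gxy -g_hm scale1r. Qed.

Lemma pr_neg1 m : grade br g x y (-1) (pr x y (-1) m).
Proof.
(* [- br y m] is corrected by [y] to become orthogonal to [x], and by [br x y] to become orthogonal
   to [br x y]. *)
rewrite prT; exists (- br y m + g h m *: y - g y m *: h); split; last first.
  by rewrite /= /pdn !brE br_xh; lmodring.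
split; rewrite gC !gE.
- by rewrite gxy g_xh -g_hm; ring.
- by rewrite gyy g_yh gzb; ring.
- by rewrite (gC h y) g_yh g_hh g_h_br_y; ring.
Qed.

Lemma pr0_br_x m : br x (pr x y 0 m) = - g h m *: x.
Proof.
rewrite prT /= /pdn !brE (brC y x) br_xyx (ext1 _ Ex) br_xh -g_hm brNr gNl br_xh.
by lmodring.
Qed.

(** In characteristic 2 the first identity gives nothing here. If [g y m] were nonzero, the second
    identity would put every [br y w] into the line of [y]; then [br x y = 0] by invariance, and [y]
    would be central. *)
Lemma g_normalizer m : normalizer br y m -> g y m = 0.
Proof.
case=> c Hc; have [//|ym0] := eqVneq (g y m) 0.
have Y w : exists e, br y w = e *: y.
  exists ((g y m)^-1 * (g y (br m w) + g y w * c - c * (g y w *+ 2))).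
  apply: (scalerI ym0); have := ext2 m w Ey; rewrite Hc brZl ext1 // => E.
  rewrite scalerA mulrA divff // mul1r.
  by apply: (eq_by_diff E); lmodring.
have [e He] := Y x.
have Hh : h = - e *: y by rewrite brC He scaleNr.
have e0 : e = 0.
  have : g x (br x h) = 0 by exact: gzb.
  rewrite Hh brZr Hh scalerA gZr gxy mulr1 => /eqP.
  by rewrite mulrNN mulf_eq0 => /orP [] /eqP.
have [] := negP ym0; apply/eqP; rewrite [y]center0 ?g0l // => w.
have [f Hf] := Y w; have := g_hm w; rewrite Hf gZr gxy Hh e0 oppr0 scale0r g0l mulr1.
by move=> <-; rewrite scale0r.
Qed.

Lemma U_pairing u : U_space br g x y u -> (g x u = 0) * (g y u = 0) * (g h u = 0).
Proof. by case=> a b c; rewrite !(gC _ u). Qed.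

Lemma pr_of_neg2 m : grade br g x y (-2) m -> forall i, pr x y i m = if i == -2 then m else 0.
Proof.
case=> c ->.
have E : pdn x y (c *: x) = 0.
  by rewrite /pdn !brE !gE gyx (gC h) g_xh (brC y x) brNr br_xh; lmodring.
have E' : pdn y x (c *: x) = 0.
  by rewrite /pdn !brE !gE (brC y x) gNl (gC h) g_xh gxx; lmodring.
case=> [[|[|[|n]]]|[|[|n]]]; rewrite prT //= ?E ?E' ?gZr ?gyx ?gxx; lmodring.
Qed.

Lemma pr_of_neg1 m : grade br g x y (-1) m -> forall i, pr x y i m = if i == -1 then m else 0.
Proof.
case=> u [/U_pairing [[ux uy] uh] ->].
have gy : g y (br x u) = 0 by rewrite -(opprK (g y _)) -g_hm' uh oppr0.
have gh : g h (br x u) = 0 by rewrite g_hm' ext1 // ux gZr; ring.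
have E : pdn x y (br x u) = br x u.
  by rewrite /pdn br_xyx uh ux gy gh; lmodring.
have E' : pdn y x (br x u) = 0.
  by rewrite /pdn ext1 // ux (brC y x) gNl gh gzb !(mul0rn, scale0r, br0r); lmodring.
case=> [[|[|[|n]]]|[|[|n]]]; rewrite prT //= ?E ?E' ?gy ?gzb; lmodring.
Qed.
End FrameHalf.

Section Frame.
Variables x y : V.
Hypotheses (Ex : ext x) (Ey : ext y) (gxy : g x y = 1).
Let gyx : g y x = 1. Proof. by rewrite gC. Qed.
Local Notation h := (br x y).

Lemma pr_of_0 m : grade br g x y 0 m -> forall i, pr x y i m = if i == 0 then m else 0.
Proof.
move=> G0.
have gy : g y m = 0 by apply: (@g_normalizer x y) => //; case: G0.
have gx : g x m = 0 by apply: (@g_normalizer y x) => //; case: G0.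
have {G0} [[c Hc] [d Hd]] := G0.
have E : pdn x y m = 0.
  by rewrite /pdn Hd gy g_hm Hd brZr gZr gxy; lmodring.
have E' : pdn y x m = 0.
  by rewrite /pdn Hc gx g_hm // Hc brZr gZr gyx; lmodring.
case=> [[|[|[|n]]]|[|[|n]]]; rewrite prT //= ?E ?E' ?gy ?gx; lmodring.
Qed.

Lemma gr_pr i m : grade br g x y i (pr x y i m).
Proof.
case: i => [[|[|[|n]]]|[|[|n]]]; [| | |by rewrite prT| | |by rewrite prT].
- split; [exists (- g (br x y) m) | exists (- g (br y x) m)]; first exact: pr0_br_x.
  by rewrite (pr_swap y x 0 m : pr x y 0 m = pr y x 0 m); apply: pr0_br_x.
- by rewrite (pr_swap y x 1 m); apply: (@grade_swap y x (-1)); apply: (pr_neg1 Ey Ex gyx m).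
- by rewrite prT; exists (g x m).
- exact: (pr_neg1 Ex Ey gxy m).
- by rewrite prT; exists (g y m).
Qed.

Lemma pr0r i : pr x y i 0 = 0.
Proof. by have := pr_lin x y i (-1) 0 0; rewrite scaler0 addr0 scaleN1r addNr. Qed.

Lemma pr_of_gr i j m : grade br g x y j m -> pr x y i m = if i == j then m else 0.
Proof.
have W k := pr_swap y x i k.
case: j => [[|[|[|n]]]|[|[|n]]] G.
- exact: pr_of_0.
- by rewrite W (pr_of_neg1 Ey gyx (grade_swap G)) eqr_oppLR.
- by rewrite W (pr_of_neg2 Ey gyx (grade_swap G)) eqr_oppLR.
- by rewrite [m]G pr0r; case: ifP.
- exact: pr_of_neg1.
- exact: pr_of_neg2.
- by rewrite [m]G pr0r; case: ifP.
Qed.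
End Frame.

Lemma gr_br_C x y i j :
  (forall u w, grade br g x y i u -> grade br g x y j w -> grade br g x y (i + j) (br u w)) ->
  forall u w, grade br g x y j u -> grade br g x y i w -> grade br g x y (j + i) (br u w).
Proof.
move=> H u w Hu Hw; by rewrite addrC brC; apply/grN/H.
Qed.

Section FrameBracket.
Variables x y : V.
Hypotheses (Ex : ext x) (Ey : ext y) (gxy : g x y = 1).
Let gyx : g y x = 1. Proof. by rewrite gC. Qed.
Local Notation h := (br x y).
Local Notation gr := (grade br g x y).
Local Notation gr_closed i j :=
  (forall u w, gr i%Z u -> gr j%Z w -> gr (i%Z + j%Z) (br u w)).

(** Invariance computes [g h n] both as [d] and as [- c], so [n] scales [x] and [y] by opposite
    factors. *)
Let br_h0 n : gr 0 n -> br n h = 0.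
Proof.
move=> G; have [[c Hc] [d Hd]] := G.
have gx : g x n = 0.
  by apply: (@g_normalizer y x) => //; case: G.
have gy : g y n = 0 by apply: (@g_normalizer x y) => //; case: G.
have cd : c + d = 0.
  have : g h n = d by rewrite g_hm Hd gZr gxy mulr1.
  by rewrite g_hm' Hc gZr gyx mulr1 => <-; rewrite addrN.
rewrite brJ (brC n x) (brC n y) Hc Hd !brE.
by rewrite -[RHS](scale0r h) -oppr0 -cd; lmodring.
Qed.

Lemma gr_h : gr 0 h.
Proof.
split; first by exists 2; rewrite br_xh.
by exists (- 2); rewrite br_yh // scaleNr.
Qed.

Lemma gr_B0n2 : gr_closed 0 (-2).
Proof. by move=> n _ [[c Hc] _] [d ->]; exists (- (d * c)); rewrite brZr brC Hc; lmodring. Qed.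

Lemma gr_B0n1 : gr_closed 0 (-1).
Proof.
move=> n _ G [u [[a b c] ->]]; have [[e He] [f Hf]] := G; exists (br n u - e *: u); split.
  split; rewrite gDl gNl gZl ?a ?b ?c mulr0 subr0 gad (brC n) ?He ?Hf ?br_h0 //.
  - by rewrite -scaleNr gZr a; ring.
  - by rewrite -scaleNr gZr b; ring.
  - by rewrite -(brC n) br_h0 // g0r oppr0.
by rewrite brJ (brC n x) He !brE; lmodring.
Qed.

Lemma gr_B00 : gr_closed 0 0.
Proof.
move=> n m [[a Ha] [b Hb]] [[c Hc] [d Hd]]; split.
  by exists 0; rewrite brJ Ha Hc !brE (brC n x) Ha Hc; lmodring.
by exists 0; rewrite brJ Hb Hd !brE (brC n y) Hb Hd; lmodring.
Qed.

Lemma gr_Bn2n2 : gr_closed (-2) (-2).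
Proof. by move=> _ _ [c ->] [d ->]; rewrite !brE !scaler0. Qed.

Lemma gr_Bn2n1 : gr_closed (-2) (-1).
Proof.
move=> _ _ [c ->] [u [[a _ _] ->]].
by rewrite !brE ext1 // (gC x) a mul0rn scale0r scaler0.
Qed.

Lemma gr_Bn21 : gr_closed (-2) 1.
Proof.
move=> _ _ [c ->] [u [[a b d] ->]]; exists (c *: br y u); rewrite brZl brZr; split=> //.
split; rewrite !gE.
- by rewrite gA (brC u) gNr -g_hm' gC d mulr0.
- by rewrite (gC _ y) gzb mulr0.
- by rewrite gC g_h_br_y // gC b; ring.
Qed.

Lemma gr_Bn22 : gr_closed (-2) 2.
Proof.
move=> _ _ [c ->] [d ->]; rewrite !brE; apply: grZ; apply: grZ; exact: gr_h.
Qed.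

Lemma gr_Bn1n1 : gr_closed (-1) (-1).
Proof.
move=> _ _ [u [[a b c] ->]] [w [[a' b' c'] ->]]; exists (g x (br u w)).
by rewrite ext2 // !(gC x) a a'; lmodring.
Qed.

Lemma normalizer_Bn11 u w : gr (-1) u -> gr 1 w -> normalizer br x (br u w).
Proof.
move=> Gu Gw; have Gx : gr (-2) x by exists 1; rewrite scale1r.
have [d Hd] := gr_Bn1n1 Gu (gr_Bn21 Gx Gw).
have Gxu : br x u = 0 by case: Gu => v [[a _ _] ->]; rewrite ext1 // gC a mul0rn scale0r.
by exists d; rewrite brJ Gxu br0l add0r Hd.
Qed.

End FrameBracket.

Section Frame2.
Variables x y : V.
Hypotheses (Ex : ext x) (Ey : ext y) (gxy : g x y = 1).
Let gyx : g y x = 1. Proof. by rewrite gC. Qed.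
Local Notation gr := (grade br g x y).
Local Notation gr_closed i j :=
  (forall u w, gr i%Z u -> gr j%Z w -> gr (i%Z + j%Z) (br u w)).

Let Bn11 : gr_closed (-1) 1.
Proof.
move=> u w Gu Gw; split; first (have Z := normalizer_Bn11 Ex Ey gxy Gu Gw; exact: Z).
rewrite /normalizer (brC u); have [d Hd] := normalizer_Bn11 Ey Ex gyx (grade_swap Gw) (grade_swap Gu).
by exists (- d); rewrite brNr Hd scaleNr.
Qed.

(** Exchanging [x] and [y] negates degrees, so each bracket rule has to be proved on one side
    only. *)
Let swap i j : (forall u w, grade br g y x i u -> grade br g y x j w ->
     grade br g y x (i + j) (br u w)) -> gr_closed (- i) (- j).
Proof.
move=> H u w Gu Gw; rewrite -opprD; apply: (@grade_swap y x); apply: H.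
  by rewrite -(opprK i); apply: grade_swap.
by rewrite -(opprK j); apply: grade_swap.
Qed.

Let P01 : gr_closed 0 1 := @swap 0 (-1) (gr_B0n1 Ey Ex gyx).
Let P02 : gr_closed 0 2 := @swap 0 (-2) (@gr_B0n2 y x).
Let P11 : gr_closed 1 1 := @swap (-1) (-1) (@gr_Bn1n1 y x Ey).
Let P21 : gr_closed 2 1 := @swap (-2) (-1) (@gr_Bn2n1 y x Ey).
Let P22 : gr_closed 2 2 := @swap (-2) (-2) (@gr_Bn2n2 y x).
Let P2n1 : gr_closed 2 (-1) := @swap (-2) 1 (gr_Bn21 Ex gyx).

Lemma gr_br i j u w : gr i u -> gr j w -> gr (i + j) (br u w).
Proof.
move: u w; case: i => [[|[|[|n]]]|[|[|n]]]; case: j => [[|[|[|k]]]|[|[|k]]];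
  try by [move=> u w -> _; rewrite br0l; apply: gr0 | move=> u w _ ->; rewrite br0r; apply: gr0].
- exact: gr_B00.
- exact: P01.
- exact: P02.
- exact: gr_B0n1.
- exact: gr_B0n2.
- exact: gr_br_C P01.
- exact: P11.
- exact: gr_br_C P21.
- exact: gr_br_C Bn11.
- exact: gr_br_C (gr_Bn21 Ey gxy).
- exact: gr_br_C P02.
- exact: P21.
- exact: P22.
- exact: P2n1.
- exact: gr_br_C (gr_Bn22 Ex Ey gxy).
- exact: gr_br_C (gr_B0n1 Ex Ey gxy).
- exact: Bn11.
- exact: gr_br_C P2n1.
- exact: gr_Bn1n1.
- exact: gr_br_C (gr_Bn2n1 Ex).
- exact: gr_br_C (@gr_B0n2 x y).
- exact: gr_Bn21.
- exact: gr_Bn22.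
- exact: gr_Bn2n1.
- exact: gr_Bn2n2.
Qed.
End Frame2.

Section Components.
Variables x y : V.
Hypotheses (Ex : ext x) (Ey : ext y) (gxy : g x y = 1).
Let gyx : g y x = 1. Proof. by rewrite gC. Qed.
Local Notation h := (br x y).
Local Notation gr := (grade br g x y).
Local Notation pr := (pr x y).

Lemma prD i u v : pr i (u + v) = pr i u + pr i v.
Proof. by rewrite -[u in LHS]scale1r pr_lin scale1r. Qed.
Lemma prZ i a u : pr i (a *: u) = a *: pr i u.
Proof. by rewrite -[_ *: u in LHS]addr0 pr_lin pr0r addr0. Qed.
Lemma prN i u : pr i (- u) = - pr i u.
Proof. by rewrite -scaleN1r prZ scaleN1r. Qed.

Lemma pr_id i m : gr i m -> pr i m = m.
Proof. by move=> G; rewrite (pr_of_gr Ex Ey gxy i G) eqxx. Qed.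

Lemma pr_range i m : (i < -2) || (2 < i) -> pr i m = 0.
Proof. by rewrite prT; case: i => [[|[|[|n]]]|[|[|n]]]. Qed.

Lemma gr_ind (P : V -> Prop) : (forall u v, P u -> P v -> P (u + v)) ->
  (forall i m, gr i m -> P m) -> forall m, P m.
Proof.
move=> PD Pgr m; rewrite [m](pr_sum x y).
have Q i := Pgr _ _ (gr_pr Ex Ey gxy i m).
exact: PD (PD _ _ (PD _ _ (PD _ _ (Q _) (Q _)) (Q _)) (Q _)) (Q _).
Qed.

Lemma g_orth i j u w : gr i u -> gr j w -> i + j != 0 -> g u w = 0.
Proof.
have g2 k v : gr k v -> k != 2 -> g x v = 0.
  move=> Gv k2; have /(congr1 (g x)) := pr_of_gr Ex Ey gxy 2 Gv.
  by rewrite prT eq_sym (negPf k2) g0r gZr gxy mulr1.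
have gn2 k v : gr k v -> k != -2 -> g y v = 0.
  move=> Gv k2; have /(congr1 (g y)) := pr_of_gr Ex Ey gxy (-2) Gv.
  by rewrite prT eq_sym (negPf k2) g0r gZr gyx mulr1.
wlog: i j u w / (i <= j).
  move=> H Gu Gw ij; have [ij'|ji] := leP i j; first exact: (H i j).
  by rewrite gC; apply: (H j i) => //; [exact: ltW|rewrite addrC].
case: i => [[|[|[|n]]]|[|[|n]]] ij; last by move->; rewrite g0l.
- case: j ij => [[|[|[|k]]]|[|[|k]]] // _; last by move=> _ -> _; rewrite g0r.
  + move=> [_ [c Hc]] [v [[_ b _] ->]] _.
    by rewrite -gA (brC u) Hc gNl gZl gC b; ring.
  + by move=> G0 [c ->] _; rewrite gC gZl (gn2 0) ?mulr0.
- case: j ij => [[|[|[|k]]]|[|[|k]]] // _; last by move=> _ -> _; rewrite g0r.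
  + move=> [v [[_ b _] ->]] [v' [[_ b' _] ->]] _.
    by rewrite gad ext1 // gZr b mulr0 oppr0.
  + by move=> G1 [c ->] _; rewrite gC gZl (gn2 1) ?mulr0.
- case: j ij => [[|[|[|k]]]|[|[|k]]] // _; last by move=> _ -> _; rewrite g0r.
  by move=> G1 [c ->] _; rewrite gC gZl (gn2 2) ?mulr0.
- by move->; rewrite g0l.
- case: j ij => [[|[|[|k]]]|[|[|k]]] // _.
  + move=> [v [[a _ _] ->]] [[c Hc] _] _.
    by rewrite gad Hc gZr a mulr0 oppr0.
  + by move=> G1 [c ->] _; rewrite gC gZl (gn2 (-1)) ?mulr0.
  + by move=> _ -> _; rewrite g0r.
  + move=> [v [[a _ _] ->]] [v' [[a' _ _] ->]] _.
    by rewrite gad ext1 // gZr a mulr0 oppr0.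
- move=> [c ->] Gw jn; rewrite gZl (g2 j) ?mulr0 //.
  by apply: contraNneq jn => ->.
Qed.

End Components.

(** * The filtration by degree and lowest components *)

Section Filtration.
Variables x y : V.
Hypotheses (Ex : ext x) (Ey : ext y) (gxy : g x y = 1).
Let gyx : g y x = 1. Proof. by rewrite gC. Qed.
Local Notation h := (br x y).
Local Notation gr := (grade br g x y).
Local Notation pr := (pr x y).

Lemma g_pr b z w : gr b w -> g z w = g (pr (- b) z) w.
Proof.
move=> Gw; rewrite {1}[z](pr_sum x y) !gDl.
have [c Ec] : exists c, c = g (pr (- b) z) w by eexists.
have F i : g (pr i z) w = if i == - b then c else 0.
  have [->|ib] := eqVneq; first by rewrite Ec.
  by rewrite (g_orth Ex Ey gxy (gr_pr Ex Ey gxy i z) Gw) // addr_eq0.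
rewrite -Ec !F; case: b Gw Ec {F} => [[|[|[|n]]]|[|[|n]]] Gw Ec; rewrite /= ?(addr0, add0r) //.
all: by rewrite Gw !g0r in Ec *.
Qed.

Lemma pr_br k u w : pr k (br u w) =
  br (pr (-2) u) (pr (k + 2) w) + br (pr (-1) u) (pr (k + 1) w) + br (pr 0 u) (pr k w) +
  br (pr 1 u) (pr (k - 1) w) + br (pr 2 u) (pr (k - 2) w).
Proof.
have F i d : pr (d + i) (br (pr i u) w) = br (pr i u) (pr d w).
  have G j : pr (d + i) (br (pr i u) (pr j w)) = if d == j then br (pr i u) (pr j w) else 0.
    have := pr_of_gr Ex Ey gxy (d + i) (gr_br Ex Ey gxy (gr_pr Ex Ey gxy i u) (gr_pr Ex Ey gxy j w)).
    by rewrite (addrC i) (inj_eq (addIr i)).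
  rewrite {1}[w](pr_sum x y) !brE !prD !G.
  case: d {G} => [[|[|[|n]]]|[|[|n]]]; rewrite /= ?(addr0, add0r) //.
    by rewrite (@pr_range x y n.+3) ?br0r.
  by rewrite (@pr_range x y (Negz n.+2)) ?br0r.
rewrite {1}[u](pr_sum x y) !brDl !prD.
rewrite -(F (-2) (k + 2)) -(F (-1) (k + 1)) -(F 0 k) -(F 1 (k - 1)) -(F 2 (k - 2)).
have -> : k + 2 + (-2) = k by lia.
have -> : k + 1 + (-1) = k by lia.
by rewrite !subrK addr0.
Qed.

Definition Fil (n : int) (m : V) : Prop := forall i, i < n -> pr i m = 0.

Lemma Fil_le n p m : Fil n m -> p <= n -> Fil p m.
Proof. by move=> F pn i ip; apply/F/(lt_le_trans ip). Qed.
Lemma FilD n u v : Fil n u -> Fil n v -> Fil n (u + v).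
Proof. by move=> Fu Fv i lt; rewrite prD Fu ?Fv ?addr0. Qed.
Lemma FilZ n a u : Fil n u -> Fil n (a *: u).
Proof. by move=> Fu i lt; rewrite prZ Fu ?scaler0. Qed.
Lemma FilN n u : Fil n u -> Fil n (- u).
Proof. by rewrite -scaleN1r; apply: FilZ. Qed.
Lemma FilB n u v : Fil n u -> Fil n v -> Fil n (u - v).
Proof. by move=> Fu /FilN; apply: FilD. Qed.
Lemma Fil0 n : Fil n 0. Proof. by move=> i _; rewrite pr0r. Qed.
Lemma Fil_gr n j m : gr j m -> n <= j -> Fil n m.
Proof.
move=> G nj i lt; rewrite (pr_of_gr Ex Ey gxy i G) (_ : (i == j) = false) //.
by apply/eqP => ij; move: lt; rewrite ij ltNge nj.
Qed.
Lemma Fil_br n p u w : Fil n u -> Fil p w -> Fil (n + p) (br u w).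
Proof.
move=> Fu Fw k lt; rewrite pr_br.
have F i d : i + d = k -> br (pr i u) (pr d w) = 0.
  move=> e; have [lti|gei] := ltP i n; first by rewrite Fu ?br0l.
  by rewrite Fw ?br0r //; lia.
by rewrite !F ?addr0 //; lia.
Qed.
Lemma Fil_br_le n p q u w : Fil n u -> Fil p w -> q <= n + p -> Fil q (br u w).
Proof. by move=> Fu Fw; apply/Fil_le/Fil_br. Qed.
Lemma Fil_gr0 d m : gr d m -> Fil (d + 1) m -> m = 0.
Proof. by move=> G F; rewrite -(pr_id Ex Ey gxy G) F //; lia. Qed.


(* The lowest-degree part of each identity for [z] is the same identity for its
   lowest component. *)
Lemma ext_low j z : ext z -> Fil j z -> ext (pr j z).
Proof.
move=> Ez Fz; have [t Et] : exists t, t = pr j z by eexists.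
have [d Ed] : exists d, d = z - t by eexists.
have Gt : gr j t by rewrite Et; exact: (gr_pr Ex Ey gxy j z).
have Ft : Fil j t by apply: Fil_gr Gt _.
have Ezt : z = t + d by rewrite Ed addrC subrK.
have Fd : Fil (j + 1) d.
  move=> i lti; rewrite Ed prD prN; have [ij|ji|->] := ltgtP i j.
  - by rewrite Fz // Ft // subrr.
  - by exfalso; lia.
  - by rewrite (pr_id Ex Ey gxy Gt) Et subrr.
rewrite -Et => {Et}.
(* Replacing [z] by [t] in [g z w *: z] costs an error of degree above [j + j + b], the degree of
   the leading terms. If [j + b] is nonzero then [g t w = 0], and [g z w] can be nonzero only when
   [j + b < 0], where all of [z] already lies that high. *)
have K b w : gr b w -> Fil (j + j + b + 1) (g z w *: z - g t w *: t).
  move=> Gw; have [e|ne] := eqVneq (j + b) 0.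
    have -> : g z w = g t w.
      rewrite Ezt gDl (g_pr d Gw) Fd ?g0l ?addr0 //; lia.
    by rewrite -scalerBr -Ed; apply: FilZ; apply: (Fil_le Fd); lia.
  rewrite (g_orth Ex Ey gxy Gt Gw ne) scale0r subr0.
  have [lt|ge] := ltP (- b) j; first by rewrite (g_pr z Gw) Fz // g0l scale0r; apply: Fil0.
  by apply: FilZ; apply: (Fil_le Fz); move/eqP: ne; lia.
have Kg b w : gr b w -> gr (j + j + b) (g t w *: t).
  move=> Gw; have [e|ne] := eqVneq (j + b) 0.
    by apply: grZ; rewrite (_ : j + j + b = j) //; lia.
  by rewrite (g_orth Ex Ey gxy Gt Gw ne) scale0r; apply: gr0.
have B := gr_br Ex Ey gxy.
have ind := @gr_ind x y Ex Ey gxy.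
have gr_eq i i' v : gr i v -> i = i' -> gr i' v by move=> Gv <-.
have I1 u : br t (br t u) = (g t u *+ 2) *: t.
  move: u; apply: (@ind _) => [u v Hu Hv|a u Gu]; first by rewrite !brE !gE Hu Hv; lmodring.
  apply/eqP; rewrite -subr_eq0; apply/eqP; apply: (@Fil_gr0 (j + j + a)).
    apply: grD; first by apply: (gr_eq _ _ _ (B _ _ _ _ Gt (B _ _ _ _ Gt Gu))); lia.
    by rewrite mulr2n scalerDl; apply: grN; apply: grD; apply: Kg.
  have Fu := Fil_gr Gu (lexx a).
  have -> : br t (br t u) - (g t u *+ 2) *: t =
      2 *: (g z u *: z - g t u *: t) - br d (br z u) - br t (br d u).
    have := ext1 u Ez => E; apply: (eq_by_diff E).
    by rewrite Ed !brE; lmodring.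
  apply: FilB; first apply: FilB.
  - by apply: FilZ; apply: K.
  - by apply: (Fil_br_le Fd (Fil_br Fz Fu)); lia.
  - by apply: (Fil_br_le Ft (Fil_br Fd Fu)); lia.
move=> u w; split; first exact: I1; move: u w.
  apply: (@ind _) => [u v Hu Hv|a u Gu] w; first by rewrite !brE !gE Hu Hv; lmodring.
  move: w; apply: (@ind _) => [w v Hu Hv|b w Gw]; first by rewrite !brE !gE Hu Hv; lmodring.
  apply/eqP; rewrite -subr_eq0; apply/eqP; apply: (@Fil_gr0 (j + j + a + b)).
    have G1 := Kg _ _ (B _ _ _ _ Gu Gw).
    have G2 := B _ _ _ _ (Kg _ _ Gw) Gu.
    have G3 := B _ _ _ _ (Kg _ _ Gu) Gw.
    rewrite !brZl in G2 G3.
    apply: grD; first by apply: (gr_eq _ _ _ (B _ _ _ _ (B _ _ _ _ Gt Gu) (B _ _ _ _ Gt Gw))); lia.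
    apply/grN/grD; first apply: grD.
    - by apply: (gr_eq _ _ _ G1); lia.
    - by apply: (gr_eq _ _ _ G2); lia.
    - by apply/grN/(gr_eq _ _ _ G3); lia.
  have Fu := Fil_gr Gu (lexx a).
  have Fw := Fil_gr Gw (lexx b).
  have -> : br (br t u) (br t w) - (g t (br u w) *: t + g t w *: br t u - g t u *: br t w) =
     (g z (br u w) *: z - g t (br u w) *: t) + br (g z w *: z - g t w *: t) u
     - br (g z u *: z - g t u *: t) w - br (br d u) (br z w) - br (br t u) (br d w).
    have := ext2 u w Ez => E; apply: (eq_by_diff E).
    by rewrite Ed !brE; lmodring.
  have F1 := K _ _ (B _ _ _ _ Gu Gw).
  have F2 := Fil_br (K _ _ Gw) Fu.
  have F3 := Fil_br (K _ _ Gu) Fw.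
  apply: FilB; first apply: FilB; first apply: FilB; first apply: FilD.
  - by apply: (Fil_le F1); lia.
  - by apply: (Fil_le F2); lia.
  - by apply: (Fil_le F3); lia.
  - by apply: (Fil_br_le (Fil_br Fd Fu) (Fil_br Fz Fw)); lia.
  - by apply: (Fil_br_le (Fil_br Ft Fu) (Fil_br Fd Fw)); lia.
apply: (@ind _) => [u v Hu Hv|a u Gu] w; first by rewrite !brE !gE Hu Hv; lmodring.
move: w; apply: (@ind _) => [w v Hu Hv|b w Gw]; first by rewrite !brE !gE Hu Hv; lmodring.
apply/eqP; rewrite -subr_eq0; apply/eqP; apply: (@Fil_gr0 (j + j + a + b)).
  have G1 := Kg _ _ (B _ _ _ _ Gu Gw).
  have G2 := B _ _ _ _ (Kg _ _ Gw) Gu.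
  have G3 := B _ _ _ _ (Kg _ _ Gu) Gw.
  rewrite !brZl in G2 G3.
  apply: grD; first by apply: (gr_eq _ _ _ (B _ _ _ _ Gt (B _ _ _ _ Gu (B _ _ _ _ Gt Gw)))); lia.
  apply/grN/grD; first apply: grD.
  - by apply: (gr_eq _ _ _ G1); lia.
  - by apply/grN/(gr_eq _ _ _ G2); lia.
  - by apply/grN/(gr_eq _ _ _ G3); lia.
have Fu := Fil_gr Gu (lexx a).
have Fw := Fil_gr Gw (lexx b).
have -> : br t (br u (br t w)) - (g t (br u w) *: t - g t w *: br t u - g t u *: br t w) =
   (g z (br u w) *: z - g t (br u w) *: t) - br (g z w *: z - g t w *: t) u
   - br (g z u *: z - g t u *: t) w - br d (br u (br z w)) - br t (br u (br d w)).
  have := ext3 u w Ez => E; apply: (eq_by_diff E).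
  by rewrite Ed !brE; lmodring.
have F1 := K _ _ (B _ _ _ _ Gu Gw).
have F2 := Fil_br (K _ _ Gw) Fu.
have F3 := Fil_br (K _ _ Gu) Fw.
apply: FilB; first apply: FilB; first apply: FilB; first apply: FilB.
- by apply: (Fil_le F1); lia.
- by apply: (Fil_le F2); lia.
- by apply: (Fil_le F3); lia.
- by apply: (Fil_br_le Fd (Fil_br Fu (Fil_br Fz Fw))); lia.
- by apply: (Fil_br_le Ft (Fil_br Fu (Fil_br Fd Fw))); lia.
Qed.
End Filtration.

Lemma ext_eq u v : ext u -> u = v -> ext v. Proof. by move=> Eu <-. Qed.

(** * The extremal geometry *)

Definition submod (S : V -> Prop) : Prop :=
  S 0 /\ forall (a : R) u v, S u -> S v -> S (a *: u + v).

Definition span (P : V -> Prop) (v : V) : Prop :=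
  forall S, submod S -> (forall u, P u -> S u) -> S v.

Lemma span_gen (P : V -> Prop) v : P v -> span P v.
Proof. by move=> Pv S _; apply. Qed.
Lemma span_submod P : submod (span P).
Proof.
split=> [S [S0 _] _ //|a u v Su Sv S SS PS].
by case: (SS) => _; apply; [exact: Su|exact: Sv].
Qed.

Section Submod.
Variables (S : V -> Prop) (SS : submod S).
Lemma submod0 : S 0. Proof. by case: SS. Qed.
Lemma submodD u v : S u -> S v -> S (u + v).
Proof. by move=> Su Sv; rewrite -[u]scale1r; case: SS => _; apply. Qed.
Lemma submodZ a u : S u -> S (a *: u).
Proof. by move=> Su; rewrite -[_ *: u]addr0; case: SS => S0; apply. Qed.
Lemma submodN u : S u -> S (- u).
Proof. by rewrite -scaleN1r; apply: submodZ. Qed.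
Lemma submodB u v : S u -> S v -> S (u - v).
Proof. by move=> Su /submodN; apply: submodD. Qed.
End Submod.

Section Geometry.
Hypothesis simple : forall I, lie_ideal br I -> (forall v, I v -> v = 0) \/ (forall v, I v).
Hypothesis nondeg : forall v, (forall u, g v u = 0) -> v = 0.
Hypothesis generated : forall S, lie_subalgebra br S -> (forall z, ext z -> S z) -> forall v, S v.

Lemma subalg_all (S : V -> Prop) : submod S -> (forall u v, S u -> S v -> S (br u v)) ->
  (forall z, ext z -> S z) -> forall v, S v.
Proof.
move=> SS Sbr; apply: generated; split=> //; [exact: submod0|exact: submodD|].
by move=> a u; apply: submodZ.
Qed.

Lemma br_submod (S : V -> Prop) z : submod S -> submod (fun v => S (br z v)).
Proof. by move=> [S0 SD]; split=> [|a u v Su Sv]; rewrite ?br0r // br_linr; apply: SD. Qed.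

Lemma brl_submod (S : V -> Prop) z : submod S -> submod (fun v => S (br v z)).
Proof. by move=> [S0 SD]; split=> [|a u v Su Sv]; rewrite ?br0l // br_linl; apply: SD. Qed.

(** The elements whose bracket preserves [span O] form a subalgebra. It contains the extremal
    elements, so it is everything, and [span O] is a nonzero ideal. *)
Lemma span_ideal (O : V -> Prop) o : O o -> o != 0 ->
  (forall v w, ext v -> O w -> span O (br v w)) -> forall m, span O m.
Proof.
move=> Oo o0 H.
have N v w : span O w -> span O (br v w).
  move: v w; apply: (@subalg_all (fun v => forall w, span O w -> span O (br v w))).
  - split=> [w _|a u v Hu Hv w Ow]; first by rewrite br0l; apply: submod0 (span_submod O).
    by rewrite br_linl; apply: (span_submod O).2; [apply: Hu|apply: Hv].
  - move=> u v Hu Hv w Ow.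
    have -> : br (br u v) w = br u (br v w) - br v (br u w) by rewrite (brJ u); lmodring.
    by apply: (submodB (span_submod O)); [apply: Hu; apply: Hv|apply: Hv; apply: Hu].
  - by move=> z Ez w Ow; apply: Ow (br_submod z (span_submod O)) _ => u Ou; apply: H.
have [|/(_ _ (span_gen Oo)) e|//] := simple (I := span O); last by rewrite e eqxx in o0.
have SO := span_submod O; split; [exact: submod0|exact: submodD| |by []].
by move=> a u; apply: submodZ.
Qed.

(** [br z w = expz z w - w - g z w *: z] is a combination of extremal elements, so their span is a
    subalgebra. *)
Lemma span_ext v : span ext v.
Proof.
have SE := span_submod ext.
move: v; apply: (subalg_all SE); last by move=> z; apply: span_gen.
move=> u v Hu Hv; apply: (Hu _ (brl_submod v SE)) => z Ez.
apply: (Hv _ (br_submod z SE)) => w Ew.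
have -> : br z w = expz z w - w - g z w *: z by rewrite /expz; lmodring.
apply: (submodB SE); last by apply: (submodZ SE); apply: span_gen.
by apply: (submodB SE); apply: span_gen => //; apply: isom_ext => //; apply: expz_isom.
Qed.

Lemma opp_ex z : z != 0 -> exists w, ext w /\ g z w = 1.
Proof.
move=> /eqP z0; apply/not_existsP => H; apply: z0; apply: nondeg => u.
apply: (span_ext u (S := fun u => g z u = 0)).
  by split=> [|a v w Hv Hw]; rewrite !gE // Hv Hw mulr0 addr0.
move=> w Ew; have [//|n0] := eqVneq (g z w) 0.
by case: (H ((g z w)^-1 *: w)); split; [apply: extZ|rewrite gZr mulVf].
Qed.

Lemma ext_normalizer z m : ext z -> normalizer br z m -> g z m = 0.
Proof.
move=> Ez N; have [->|z0] := eqVneq z 0; first by rewrite g0l.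
have [w [Ew gzw]] := opp_ex z0.
by apply: (@g_normalizer w z) => //; rewrite gC.
Qed.

(** The Weyl element of the [SL_2] of a hyperbolic pair would have a third factor [expz x], applied
    first; it fixes [x], so two factors suffice to send [x] to [y]. *)
Definition weyl x y m := expz x (expz y m).

Lemma weyl_isom x y : ext x -> ext y -> isom (weyl x y).
Proof. by move=> Ex Ey; apply: (isom_comp (expz_isom Ex) (expz_isom Ey)). Qed.

Lemma weylE x y : ext x -> ext y -> g x y = 1 -> weyl x y x = y.
Proof.
move=> Ex Ey gxy; rewrite /weyl /expz (brC y x) (gC y) gxy !brE !gE.
by rewrite br_xh // g_xh gxy (ext_gzz Ex); lmodring.
Qed.

Lemma expz_fix z m : br z m = 0 -> g z m = 0 -> expz z m = m.
Proof. by rewrite /expz => -> ->; lmodring. Qed.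

(** * Existence of a special pair *)

Section SpecialPair.
Variables (a0 b0 : V).
Hypotheses (ab0 : br a0 b0 = 0) (indep : forall p q, p *: a0 + q *: b0 = 0 -> p = 0 /\ q = 0)
  (Eab : forall p q, ext (p *: a0 + q *: b0)).

(** Suppose that orthogonal extremal elements always commute. Moving the given line by [weyl] maps
    completes it to a quadrangle [a], [e], [d], [f] of lines, with opposite corners [a], [d] and
    [e], [f]. Then [br a d = br e f] commutes with every extremal element, hence is 0, against
    [g a d = 1]. *)
Lemma special_pair : exists z w, [/\ ext z, ext w, g z w = 0 & br z w != 0].
Proof.
apply: contrapT => NS'.
have NS z w : ext z -> ext w -> g z w = 0 -> br z w = 0.
  by move=> Ez Ew gzw; apply/eqP; apply: contrapT => n0; apply: NS'; exists z, w; split=> //; apply/negP.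
have b0n : b0 != 0.
  by apply/eqP => b0e; case: (@indep 0 1) => [|_ /eqP]; rewrite ?b0e ?scale0r ?scaler0 ?addr0 // oner_eq0.
have [f [Ef gbf]] := opp_ex b0n.
have [a [Ea Eae ae gaf]] : exists a, [/\ a != 0, forall p q, ext (p *: a + q *: b0),
   br a b0 = 0 & g a f = 0].
  exists (a0 - g a0 f *: b0); split.
  - apply/eqP => e; case: (@indep 1 (- g a0 f)) => [|/eqP]; last by rewrite oner_eq0.
    by rewrite -[RHS]e; lmodring.
  - move=> p q; apply: (ext_eq (Eab p (q - p * g a0 f))); lmodring.
  - by rewrite !brE ab0; lmodring.
  - by rewrite !gE gbf; ring.
have [d0 [Ed0 gad0]] := opp_ex Ea.
have Eext : ext a by have := Eae 1 0; rewrite scale1r scale0r addr0.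
have [e [Ep eb ged0 gef]] : exists e, [/\ forall p q, ext (p *: a + q *: e),
   br a e = 0, g e d0 = 0 & g e f = 1].
  exists (b0 - g b0 d0 *: a); split.
  - move=> p q; apply: (ext_eq (Eae (p - q * g b0 d0) q)); lmodring.
  - by rewrite !brE ae; lmodring.
  - by rewrite !gE gad0; ring.
  - by rewrite !gE gaf gbf; ring.
have Ee : ext e by have := Ep 0 1; rewrite scale1r scale0r add0r.
have ga_e : g a e = 0 by apply: ext_normalizer => //; exists 0; rewrite scale0r.
have I1 := weyl_isom Eext Ed0.
have fix1 : weyl a d0 e = e.
  rewrite /weyl (expz_fix (z := d0)) ?expz_fix //; first by apply: NS; rewrite // gC.
  by rewrite gC.
have [d [[Ed Edp] gad' ged gfd]] : exists d, [/\ ext d /\ (forall p q, ext (p *: d + q *: e)),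
    g a d = 1, g e d = 0 & g f d = 0].
  have Edp p q : ext (p *: (d0 - g f d0 *: e) + q *: e).
    have := isom_ext I1 (Ep p (q - p * g f d0)).
    by rewrite !(isomE I1) fix1 weylE // => H; apply: (ext_eq H); lmodring.
  exists (d0 - g f d0 *: e); split.
  - split=> //; by have := Edp 1 0; rewrite scale1r scale0r addr0.
  - by rewrite !gE gad0 ga_e; ring.
  - by rewrite !gE ged0 (ext_gzz Ee); ring.
  - by rewrite !gE (gC f e) gef; ring.
have af : br a f = 0 by apply: NS.
have ed : br e d = 0 by apply: NS.
have fd : br f d = 0 by apply: NS.
have I2 := weyl_isom Ee Ef.
have fix2 m : br e m = 0 -> g e m = 0 -> br f m = 0 -> g f m = 0 -> weyl e f m = m.
  by move=> *; rewrite /weyl (expz_fix (z := f)) // expz_fix.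
have Eaf p q : ext (p *: a + q *: f).
  have := isom_ext I2 (Ep p q).
  by rewrite !(isomE I2) weylE // fix2 // 1?gC // brC ?eb ?af oppr0.
have Edf p q : ext (p *: d + q *: f).
  by have := isom_ext I2 (Edp p q); rewrite !(isomE I2) weylE // fix2.
(* The second identity for the extremal element [a + e], applied to [d] and [f], has left side 0 and
   right side [br a d - br e f]. *)
have hE : br a d = br e f.
  have Eaee : ext (a + e) by have := Ep 1 1; rewrite !scale1r.
  have A1 : br (a + e) d = br a d by rewrite brDl ed addr0.
  have A2 : br (a + e) f = br e f by rewrite brDl af add0r.
  have af' : br a (br e f) = 0 by rewrite brJ eb af br0l br0r addr0.
  have df' : br d (br e f) = 0 by rewrite brJ (brC d e) ed (brC d f) fd oppr0 br0l br0r addr0.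
  have X : br (br a d) (br e f) = br a (br d (br e f)) - br d (br a (br e f)).
    by rewrite (brJ a); lmodring.
  have := ext2 d f Eaee.
  rewrite A1 A2 X af' df' !br0r (brC d f) fd oppr0 g0r !gDl gaf gef gad' ged => E.
  by apply: (eq_by_diff (esym E)); lmodring.
(* The combination of [p] and [q] that is orthogonal to [z] is extremal, so it commutes with [z]. *)
have prop z p q : ext z -> (forall r s, ext (r *: p + s *: q)) ->
    g z q *: br z p = g z p *: br z q.
  move=> Ez Epq; apply/eqP; rewrite -subr_eq0 -!brZr -brNr -brDr -scaleNr; apply/eqP; apply: NS => //.
  by rewrite !gE; ring.
(* If [g z p] is nonzero for [p = a] or [p = d], then [br z e] and [br z f] are multiples of
   [br z p], and the two terms of the Jacobi identity cancel. Otherwise [z] commutes with [a] and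
   [d]. *)
have zh z : ext z -> br z (br e f) = 0.
  move=> Ez.
  have H p : br p e = 0 -> br p f = 0 -> (forall r s, ext (r *: p + s *: e)) ->
    (forall r s, ext (r *: p + s *: f)) -> g z p != 0 -> br z (br e f) = 0.
    move=> pe pf Epe Epf zp.
    have D q : (forall r s, ext (r *: p + s *: q)) -> br z q = (g z q / g z p) *: br z p.
      by move=> Epq; apply: (scalerI zp); rewrite -(prop z p q) // scalerA mulrC divfK.
    have [ke ze] : exists k, br z e = k *: br z p by eexists; apply: D.
    have [kf zf] : exists k, br z f = k *: br z p by eexists; apply: D.
    have X1 : br (br z p) f = - (kf *: br p (br z p)).
      by have := brJ z p f; rewrite pf br0r zf brZr => /esym/eqP; rewrite addr_eq0 => /eqP.
    have X2 : br e (br z p) = ke *: br p (br z p).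
      by rewrite brJ (brC e z) ze (brC e p) pe oppr0 br0r addr0 brNl brZl (brC _ p) scalerN opprK.
    by rewrite brJ ze zf brZl brZr X1 X2; lmodring.
  have [za|za] := eqVneq (g z a) 0; last by apply: (H a).
  have [zd|zd] := eqVneq (g z d) 0; last by apply: (H d) => //; rewrite brC ?ed ?fd oppr0.
  by rewrite -hE brJ (NS z a) // (NS z d) // br0l br0r addr0.
have h0 : br a d = 0.
  rewrite hE; apply: center0 => v; rewrite brC; apply/eqP; rewrite oppr_eq0; apply/eqP.
  apply: (span_ext v (S := fun v => br v (br e f) = 0)) => //.
  by split=> [|k u w Hu Hw]; rewrite !brE // Hu Hw scaler0 addr0.
(* Once [br a d = 0], the third identity for [a], [d], [w] shrinks to [g a d *: br a w = 0], so [a]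
   is central. *)
case/eqP: Ea; apply: center0 => w.
have dw : br d (br a w) = br a (br d w).
  by rewrite brJ (brC d a) h0 oppr0 br0l add0r.
have gdw : g a (br d w) = 0 by rewrite -gA h0 g0l.
have := ext3 d w Eext; rewrite dw ext1 // gdw h0 gad' => E.
by apply: oppr_inj; rewrite oppr0; apply: (eq_by_diff (esym E)); lmodring.
Qed.
End SpecialPair.

(** * Neighbours of a point *)

(* Collinearity as read off from the grading. In characteristic 2 it is stronger than
   [collinear], which can also hold when [f] has degree 0. *)
Definition nbr (e f : V) : Prop :=
  [/\ ext f, ~ (exists c : R, f = c *: e) & exists m, g e m = 0 /\ f = br e m].

Section Neighbours.
Variables x y : V.
Hypotheses (Ex : ext x) (Ey : ext y) (gxy : g x y = 1).
Let gyx : g y x = 1. Proof. by rewrite gC. Qed.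
Local Notation h := (br x y).
Local Notation gr := (grade br g x y).
Local Notation pr := (pr x y).
Let grb := gr_br Ex Ey gxy.
Let orth := g_orth Ex Ey gxy.
Let grp := gr_pr Ex Ey gxy.

Lemma gr_x : gr (-2) x. Proof. by exists 1; rewrite scale1r. Qed.
Lemma gr_y : gr 2 y. Proof. by exists 1; rewrite scale1r. Qed.

Lemma br_yxu u : gr 1 u -> br y (br x u) = - u.
Proof.
move=> Gu; have := pr_id Ex Ey gxy Gu; rewrite prT /= /pdn (brC y x).
rewrite gNl (orth (gr_h Ex Ey gxy) Gu) // (orth gr_x Gu) // => E.
by apply: (eq_by_diff (esym E)); lmodring.
Qed.

Lemma br_hu u : gr 1 u -> br h u = u.
Proof.
move=> Gu; have := brJ x y u.
have -> : br y u = 0 by exact: (grb gr_y Gu).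
by rewrite br_yxu // br0r => E; apply: (eq_by_diff (esym E)); lmodring.
Qed.

Lemma low_eq j d r : gr j d -> Fil x y (j + 1) r -> pr j (d + r) = d /\ Fil x y j (d + r).
Proof.
move=> Gd Fr; rewrite prD (pr_id Ex Ey gxy Gd) Fr ?addr0; last by lia.
split=> //; apply: FilD; last by apply: (Fil_le Fr); lia.
exact: (Fil_gr Ex Ey gxy Gd).
Qed.

Lemma ext_leading j d r : gr j d -> Fil x y (j + 1) r -> ext (d + r) -> ext d.
Proof.
move=> Gd Fr E; have [e F] := low_eq Gd Fr.
by rewrite -e; exact: (ext_low Ex Ey gxy E F).
Qed.

(** [br x b] is the lowest component of [expz x b = b + br x b]. *)
Lemma ext_br_x b : gr 1 b -> ext b -> ext (br x b).
Proof.
move=> Gb Eb; apply: (@ext_leading (-1) _ b); first exact: (grb gr_x Gb).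
  by apply: (Fil_gr Ex Ey gxy Gb).
have := isom_ext (expz_isom Ex) Eb.
by rewrite /expz (orth gr_x Gb) // scale0r addr0 addrC.
Qed.

Lemma expz_xb s b : gr 1 b -> expz (s *: br x b) y = y + s *: b.
Proof.
move=> Gb; have Gd : gr (-1) (br x b) by exact: (grb gr_x Gb).
by rewrite /expz brZl (brC (br x b)) br_yxu // gZl (orth Gd gr_y) //; lmodring.
Qed.

(** For nonzero [c], [b + c *: y] is [c] times the image of [y] under the exponential of
    [c^-1 *: br x b]. *)
Lemma ext_line b c : gr 1 b -> ext b -> ext (b + c *: y).
Proof.
move=> Gb Eb; have [->|c0] := eqVneq c 0; first by rewrite scale0r addr0.
have H := isom_ext (expz_isom (extZ c^-1 (ext_br_x Gb Eb))) Ey.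
apply: (ext_eq (extZ c H)); rewrite expz_xb //.
by rewrite scalerDr scalerA mulfV // scale1r addrC.
Qed.

Let y0 : y != 0.
Proof. by apply/eqP => e; move: gxy; rewrite e g0r => /esym/eqP; rewrite oner_eq0. Qed.

Lemma not_multiple b c : gr 1 b -> b != 0 -> ~ exists k, b + c *: y = k *: y.
Proof.
move=> Gb /eqP b0 [k /(congr1 (pr 1))]; rewrite prD !prZ (pr_id Ex Ey gxy Gb).
by rewrite (pr_of_gr Ex Ey gxy 1 gr_y) !scaler0 addr0.
Qed.

(** By [br_y_gr0] this [n] satisfies [br y n = y]. A multiple of [h] would serve except in
    characteristic 2, where [g h h = -2] vanishes. Nondegeneracy always gives [n], because [h] fixes
    [b] under the bracket and so is nonzero. *)
Lemma dual_h b : gr 1 b -> b != 0 -> exists n, gr 0 n /\ g h n = 1.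
Proof.
move=> Gb b0; have h0 : h != 0.
  by apply: contraNneq b0 => h0; rewrite -(br_hu Gb) h0 br0l.
have [n Hn] : exists n, g h n != 0.
  apply: contrapT => H; case/eqP: h0; apply: nondeg => u; apply/eqP.
  by apply: contrapT => nz; apply: H; exists u; apply/negP.
exists ((g h n)^-1 *: pr 0 n); split; first exact/grZ/grp.
have E : g n h = g (pr 0 n) h by exact: (g_pr Ex Ey gxy n (gr_h Ex Ey gxy)).
by rewrite gZr (gC h (pr 0 n)) -E (gC n h) mulVf.
Qed.

Lemma br_y_gr0 n : gr 0 n -> br y n = g h n *: y.
Proof. by move=> G0; case: (G0) => _ [c Hc]; rewrite Hc g_hm Hc gZr gxy mulr1. Qed.

(** With its converse [nbr_frame], this describes the neighbours of [y] in coordinates. In the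
    witness [c *: n - br x b], the bracket with [y] turns [n] into [y] and [- br x b] into [b]. *)
Lemma nbr_of b c : gr 1 b -> ext b -> b != 0 -> nbr y (b + c *: y).
Proof.
move=> Gb Eb b0; split; [exact: ext_line|exact: not_multiple|].
have [n [Gn gn]] := dual_h Gb b0.
have Gd : gr (-1) (br x b) by exact: (grb gr_x Gb).
exists (c *: n - br x b); rewrite !gE (orth gr_y Gn) // (orth gr_y Gd) //; split; first by ring.
by rewrite brDr brZr brNr br_y_gr0 // gn br_yxu //; lmodring.
Qed.

Lemma br_y_low m : g y m = 0 -> br y m = br y (pr (-1) m) + g h (pr 0 m) *: y.
Proof.
move=> gm; rewrite {1}[m](pr_sum x y) !brDr (br_y_gr0 (grp 0 m)).
have -> : pr (-2) m = 0 by rewrite prT /= gm scale0r.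
have -> : br y (pr 1 m) = 0 by exact: (grb gr_y (grp 1 m)).
have -> : br y (pr 2 m) = 0 by exact: (grb gr_y (grp 2 m)).
by rewrite br0r add0r !addr0.
Qed.

Lemma nbr_frame f : nbr y f ->
  exists b c, [/\ f = b + c *: y, gr 1 b, b != 0 & ext b].
Proof.
move=> [Ef nf [m [gm fE]]]; exists (br y (pr (-1) m)), (g h (pr 0 m)).
have Gb : gr 1 (br y (pr (-1) m)) by exact: (grb gr_y (grp (-1) m)).
rewrite -br_y_low // -fE; split=> //.
  by apply/eqP => b0; apply: nf; exists (g h (pr 0 m)); rewrite fE br_y_low // b0 add0r.
apply: (ext_leading Gb (r := g h (pr 0 m) *: y)).
  by apply: (Fil_gr Ex Ey gxy (j := 2)) => //; apply/grZ/gr_y.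
by rewrite -br_y_low // -fE.
Qed.

(** The bracket is an alternating form on degree 1 with values in the line of [y]. Under [br y] it
    corresponds to the pairing [g] of degree 1 with degree -1, so it inherits nondegeneracy. *)
Lemma omega_dual b : gr 1 b -> b != 0 -> exists w, gr 1 w /\ br b w = y.
Proof.
move=> Gb /eqP b0; have [u gbu] : exists u, g b u != 0.
  apply: contrapT => H; apply: b0; apply: nondeg => u; apply/eqP.
  by apply: contrapT => nz; apply: H; exists u; apply/negP.
have Gw : gr 1 (br y (pr (-1) u)) by exact: (grb gr_y (grp (-1) u)).
have [c Hc] : gr 2 (br b (br y (pr (-1) u))) by exact: (grb Gb Gw).
have cE : c = g b u.
  have : g x (br b (br y (pr (-1) u))) = c by rewrite Hc gZr gxy mulr1.
  rewrite -gA -gA (brC _ y) br_yxu // opprK => <-.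
  by have := g_pr Ex Ey gxy u Gb; rewrite !(gC _ b).
exists ((g b u)^-1 *: br y (pr (-1) u)); split; first exact: grZ.
by rewrite brZr Hc cE scalerA mulVf // scale1r.
Qed.

Lemma nbr_sym_frame f : nbr y f -> nbr f y.
Proof.
move=> /nbr_frame [b [c [-> Gb b0 Eb]]]; split=> //.
  move=> [k E]; have := congr1 (pr 1) E.
  rewrite prZ prD prZ (pr_id Ex Ey gxy Gb) (pr_of_gr Ex Ey gxy 1 gr_y) scaler0 addr0.
  move=> /esym/eqP; rewrite scaler_eq0 (negPf b0) orbF => /eqP k0.
  by move: y0; rewrite E k0 scale0r eqxx.
have [w [Gw bw]] := omega_dual Gb b0.
have yw : br y w = 0 by exact: (grb gr_y Gw).
exists w; rewrite !gE (orth Gb Gw) // (orth gr_y Gw) // !brE bw yw; split; first by ring.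
by rewrite scaler0 addr0.
Qed.

End Neighbours.

Section Special.
Variables x y : V.
Hypotheses (Ex : ext x) (Ey : ext y) (gxy : g x y = 1).
Let gyx : g y x = 1. Proof. by rewrite gC. Qed.
Local Notation h := (br x y).
Local Notation gr := (grade br g x y).
Local Notation pr := (pr x y).
Let grb := gr_br Ex Ey gxy.
Let orth := g_orth Ex Ey gxy.
Let grp := gr_pr Ex Ey gxy.

Let y0 : y != 0.
Proof. by apply/eqP => e; move: gxy; rewrite e g0r => /esym/eqP; rewrite oner_eq0. Qed.

Lemma br_xyd d : gr (-1) d -> br x (br y d) = - d.
Proof. by move=> /grade_swap Gd; apply: (@br_yxu y x). Qed.

Lemma ext_br_y d : gr (-1) d -> ext d -> ext (br y d).
Proof. by move=> /grade_swap Gd; apply: (@ext_br_x y x). Qed.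

Lemma gr_br_y d : gr (-1) d -> gr 1 (br y d).
Proof. exact: (grb (gr_y x y)). Qed.

(** As [g y z = 0], [z] starts in degree -1; its component [d] there is extremal, and [br y z] is
    [br y d] plus a multiple of [y]. If [d] were 0, the component [n] of degree 0 would be extremal,
    and [br n (br n y) = 0] would force [br n y = 0], hence [br y z = 0]. *)
Lemma special_frame z : ext z -> g y z = 0 -> br y z != 0 -> nbr y (br y z).
Proof.
move=> Ez gz yz.
have yl := br_y_low Ex Ey gxy gz.
have gr_y := gr_y x y.
have Fz : Fil x y (-1) z.
  move=> i lt; have [->|ne] := eqVneq i (-2); first by rewrite prT /= gz scale0r.
  by rewrite pr_range //; apply/orP; left; lia.
have Ed := ext_low Ex Ey gxy Ez Fz; have Gd := grp (-1) z.
have d0 : pr (-1) z != 0.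
  apply/eqP => d0; have Fz0 : Fil x y 0 z.
    by move=> i lt; have [->|ne] := eqVneq i (-1); [|apply: Fz; lia].
  have En := ext_low Ex Ey gxy Ez Fz0; have Gn := grp 0 z.
  have yn := br_y_gr0 gxy Gn.
  have ny : br (pr 0 z) y = - g h (pr 0 z) *: y by rewrite brC yn scaleNr.
  have := ext1 y En; rewrite ny brZr ny (orth Gn gr_y) // mul0rn scale0r scalerA mulrNN.
  move=> /eqP; rewrite scaler_eq0 (negPf y0) orbF mulf_eq0 orbb => /eqP h0.
  by move: yz; rewrite yl d0 h0 br0r scale0r add0r eqxx.
have b0 : br y (pr (-1) z) != 0.
  by apply: contraNneq d0 => b0; rewrite -[pr _ _]opprK -(br_xyd Gd) b0 br0r oppr0.
rewrite yl; apply: (nbr_of Ex Ey gxy) => //; first exact: gr_br_y.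
exact: ext_br_y.
Qed.

End Special.

Lemma frame_ex e : e != 0 -> exists w, ext w /\ g w e = 1.
Proof. by move=> /opp_ex [w [Ew gw]]; exists w; rewrite gC. Qed.

Lemma br_neq0l u v : br u v != 0 -> u != 0.
Proof. by apply: contraNneq => ->; rewrite br0l. Qed.

Lemma nbr_ext e f : nbr e f -> ext f. Proof. by case. Qed.

Lemma nbr_sym e f : ext e -> e != 0 -> nbr e f -> nbr f e.
Proof. by move=> Ee /frame_ex [w [Ew gw]]; apply: nbr_sym_frame Ew Ee gw f. Qed.

Lemma nbr_line e f c : ext e -> e != 0 -> nbr e f -> nbr e (f + c *: e).
Proof.
move=> Ee /frame_ex [w [Ew gw]] /(nbr_frame Ew Ee gw) [b [d [-> Gb b0 Eb]]].
by rewrite -addrA -scalerDl; apply: (nbr_of Ew Ee gw).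
Qed.

Lemma special_nbr e z : ext e -> ext z -> g e z = 0 -> br e z != 0 -> nbr e (br e z).
Proof.
move=> Ee Ez gez ez; have [w [Ew gw]] := frame_ex (br_neq0l ez).
exact: (special_frame Ew Ee gw).
Qed.

Lemma nbr_isom th e f : isom th -> nbr e f -> nbr (th e) (th f).
Proof.
move=> I [Ef nf [m [gm fE]]]; split.
- exact: isom_ext.
- move=> [c fc]; apply: nf; exists c; rewrite -(isomZ I) in fc.
  by case: (I) => _ b _ _; apply: (bij_inj b).
- by case: I => _ _ hb hg; exists (th m); rewrite hg -hb fE.
Qed.

Lemma nbr_scale c e f : c != 0 -> nbr (c *: e) f -> nbr e f.
Proof.
move=> c0 [Ef nf [m [gm fE]]]; split=> //.
  by move=> [d fd]; apply: nf; exists (d / c); rewrite scalerA divfK.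
by exists (c *: m); rewrite gZr -gZl fE brZr -brZl.
Qed.

(** The last clause records that [th] is a product of exponentials of [v] and of a multiple of [o];
    taken for [S := W], it makes [th] preserve [W]. *)
Lemma opp_isom v o : ext v -> ext o -> g v o != 0 ->
  exists th c, [/\ isom th, c != 0, th o = c *: v &
    forall S, (forall u, ext u -> S u -> forall m, S m -> S (expz u m)) ->
      (forall a u, S u -> S (a *: u)) -> S v -> S o -> forall m, S m -> S (th m)].
Proof.
move=> Ev Eo vo; have Eo' := extZ (g v o)^-1 Eo.
have I := weyl_isom Eo' Ev.
exists (weyl ((g v o)^-1 *: o) v), (g v o); split=> //.
  have E : weyl ((g v o)^-1 *: o) v ((g v o)^-1 *: o) = v by rewrite weylE // gZl (gC o v) mulVf.
  by apply: (scalerI (invr_neq0 vo)); rewrite -(isomZ I) E scalerA mulVf // scale1r.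
by move=> S Sx SZ Sv So m Sm; exact: Sx _ Eo' (SZ _ _ So) _ (Sx _ Ev Sv _ Sm).
Qed.

(** Otherwise [z] is orthogonal to the whole orbit of [y], by [opp_isom]. The span of the orbit is
    an ideal, since [br v o = expz v o - o - g v o *: v] and [v] is in the orbit as soon as [g v o]
    is nonzero. So [z] would lie in the radical of [g]. *)
Lemma point_transitive y z : ext y -> y != 0 -> ext z -> z != 0 ->
  exists th c, [/\ isom th, c != 0 & th y = c *: z].
Proof.
move=> Ey y0 Ez z0; pose O e := [/\ ext e, e != 0 & exists th c, [/\ isom th, c != 0 & th y = c *: e]].
have move_to v o : ext v -> O o -> g v o != 0 -> O v.
  move=> Ev [Eo _ [th [c [I c0 E]]]] vo.
  have v0 : v != 0 by apply: contraNneq vo => ->; rewrite g0l.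
  have [th' [c' [I' c0' E' _]]] := opp_isom Ev Eo vo.
  split=> //; exists (th' \o th), (c * c'); split; [exact: isom_comp|by rewrite mulf_neq0|].
  by rewrite /= E (isomE I') E' scalerA.
apply: contrapT => nO; case/eqP: z0; apply: nondeg => u.
have Oy : O y.
  split=> //; exists id, 1; rewrite oner_neq0 scale1r; split=> //; split=> //.
  by exists id.
apply: (@span_ideal O y Oy y0 _ u (fun u => g z u = 0)); last 1 first.
- move=> o Oo; apply/eqP; apply: contrapT => /negP zo.
  by apply: nO; case: (move_to z o Ez Oo zo).
- move=> v o Ev Oo; have SO := span_submod O.
  have -> : br v o = expz v o - o - g v o *: v by rewrite /expz; lmodring.
  apply: (submodB SO); first apply: (submodB SO).
  + apply: span_gen; have [Eo o0 [th [c [I c0 E]]]] := Oo; have Iv := expz_isom Ev.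
    split; first exact: isom_ext.
      apply: contraNneq o0 => e; case: Iv => _ b _ _; apply/eqP/(bij_inj b).
      by rewrite e /expz br0r g0r; lmodring.
    exists (expz v \o th), c; split=> //; first exact: isom_comp.
    by rewrite /= E (isomE Iv).
  + exact: span_gen.
  + have [->|vo] := eqVneq (g v o) 0; first by rewrite scale0r; apply: submod0.
    by apply: (submodZ SO); apply: span_gen; apply: (move_to v o).
- by split=> [|a v w Hv Hw]; rewrite !gE // Hv Hw mulr0 addr0.
Qed.

Hypothesis special : exists z w, [/\ ext z, ext w, g z w = 0 & br z w != 0].

Lemma nbr_ex y : ext y -> y != 0 -> exists f, nbr y f.
Proof.
move=> Ey y0; have [z [w [Ez Ew gzw zw]]] := special.
have [th [c [I c0 E]]] := point_transitive Ez (br_neq0l zw) Ey y0.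
exists (th (br z w)); apply: (nbr_scale c0); rewrite -E; apply: nbr_isom => //.
exact: special_nbr.
Qed.

(** * The torus of a hyperbolic pair *)

Definition torus_def (x y : V) (l : R) (m : V) : V :=
  l ^ (-2) *: pr x y (-2) m + l ^ (-1) *: pr x y (-1) m + pr x y 0 m
  + l *: pr x y 1 m + l ^+ 2 *: pr x y 2 m.
Definition torus := locked torus_def.

Lemma torusT : torus = torus_def. Proof. by rewrite /torus -lock. Qed.

Lemma torus_lin x y l a u v :
  torus x y l (a *: u + v) = a *: torus x y l u + torus x y l v.
Proof. by rewrite torusT /torus_def !pr_lin; lmodring. Qed.

Lemma torus_gr x y l i m : ext x -> ext y -> g x y = 1 -> grade br g x y i m ->
  torus x y l m = l ^ i *: m.
Proof.
move=> Ex Ey gxy Gm; rewrite torusT /torus_def !(pr_of_gr Ex Ey gxy _ Gm).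
case: i Gm => [[|[|[|n]]]|[|[|n]]] Gm /=;
  rewrite ?(scaler0, addr0, add0r, expr0z, scale1r, expr1z) //.
- by rewrite Gm scaler0.
- by rewrite Gm scaler0.
Qed.

Lemma torus_isom x y l : ext x -> ext y -> g x y = 1 -> l != 0 -> isom (torus x y l).
Proof.
move=> Ex Ey gxy l0.
have ind := @gr_ind x y Ex Ey gxy.
have tg := torus_gr _ Ex Ey gxy.
have tD k u v : torus x y k (u + v) = torus x y k u + torus x y k v.
  by have := torus_lin x y k 1 u v; rewrite !scale1r.
have K k : k != 0 -> cancel (torus x y k) (torus x y k^-1).
  move=> k0; apply: (@ind _) => [u v Hu Hv|i u Gu]; first by rewrite !tD Hu Hv.
  by rewrite (tg _ _ _ Gu) (tg _ i) ?scalerA; [rewrite exprz_inv -expfzDr // addNr expr0z scale1r|apply: grZ].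
split.
- exact: torus_lin.
- exists (torus x y l^-1); first exact: K.
  by have := K l^-1; rewrite invrK invr_eq0; apply.
- apply: (@ind _) => [u v Hu Hv|i u Gu] w; first by rewrite brDl !tD Hu Hv brDl.
  move: w; apply: (@ind _) => [w v Hu Hv|j w Gw]; first by rewrite brDr !tD Hu Hv brDr.
  rewrite (tg _ _ _ Gu) (tg _ _ _ Gw) (tg _ _ _ (gr_br Ex Ey gxy Gu Gw)).
  by rewrite !brE scalerA expfzDr // mulrC.
- apply: (@ind _) => [u v Hu Hv|i u Gu] w; first by rewrite !tD !gE Hu Hv.
  move: w; apply: (@ind _) => [w v Hu Hv|j w Gw]; first by rewrite !tD !gE Hu Hv.
  rewrite (tg _ _ _ Gu) (tg _ _ _ Gw) !gE.
  have [ij|ij] := eqVneq (i + j) 0; last by rewrite (g_orth Ex Ey gxy Gu Gw) // !mulr0.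
  by rewrite mulrA -expfzDr // ij expr0z mul1r.
Qed.

Hypothesis large : exists l : R, l != 0 /\ l != 1.

(** * The degree-1 component is spanned by extremal elements *)

Definition spanE1 (x y : V) : V -> Prop := span (fun b => grade br g x y 1 b /\ ext b).

Definition normE1 (x y n : V) : Prop := forall s, spanE1 x y s -> spanE1 x y (br n s).

Definition subE1 (x y m : V) : Prop :=
  [/\ spanE1 x y (pr x y 1 m), spanE1 y x (pr x y (-1) m),
      normE1 x y (pr x y 0 m) & normE1 y x (pr x y 0 m)].

Lemma spanE1_submod x y : submod (spanE1 x y). Proof. exact: span_submod. Qed.

Lemma normE1_submod x y : submod (normE1 x y).
Proof.
split=> [s _|a u v Hu Hv s Hs]; first by rewrite br0l; apply: submod0 (spanE1_submod _ _).
by rewrite br_linl; apply: (spanE1_submod x y).2; [apply: Hu|apply: Hv].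
Qed.

Lemma spanE1_gr x y s : spanE1 x y s -> grade br g x y 1 s.
Proof.
move=> H; apply: (H (grade br g x y 1)); last by move=> b [].
split=> [|a u v Gu Gv]; [exact: gr0|exact: gr_lin].
Qed.

Lemma subE1_swap x y m : subE1 x y m -> subE1 y x m.
Proof. by case=> a b c d; split; rewrite pr_swap. Qed.

Lemma subE1_submod x y : submod (subE1 x y).
Proof.
have S := spanE1_submod x y; have S' := spanE1_submod y x.
have N := normE1_submod x y; have N' := normE1_submod y x.
split=> [|a u v [? ? ? ?] [? ? ? ?]].
  by split; rewrite pr0r; [case: S|case: S'|case: N|case: N'].
by split; rewrite pr_lin; [apply: S.2|apply: S'.2|apply: N.2|apply: N'.2].
Qed.

Section SpanHalf.
Variables x y : V.
Hypotheses (Ex : ext x) (Ey : ext y) (gxy : g x y = 1).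
Let gyx : g y x = 1. Proof. by rewrite gC. Qed.
Local Notation gr := (grade br g x y).
Local Notation S := (spanE1 x y).
Let SS : submod S := spanE1_submod x y.
Let grb := gr_br Ex Ey gxy.
Let orth := g_orth Ex Ey gxy.

Lemma spanE1_br_y s : spanE1 y x s -> S (br y s).
Proof.
move=> Hs; apply: (Hs _ (br_submod y SS)).
move=> d [/grade_swap Gd Ed]; apply: span_gen; split; first exact: (gr_br_y Ex Ey gxy).
by apply: (@ext_br_y x y).
Qed.

(** If [g b d = 0], then [br b d] is 0 or extremal of degree 0, and its exponential maps [c] to
    [c + br (br b d) c]. If not, [d] and [b] form a hyperbolic pair after scaling, and its torus is
    applied to [c]. *)
Lemma spanE1_triple b c d : gr 1 b -> ext b -> gr 1 c -> ext c -> gr (-1) d -> ext d ->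
  S (br (br b d) c).
Proof.
move=> Gb Eb Gc Ec Gd Ed.
have Sc : S c by apply: span_gen.
have [gbd|gbd] := eqVneq (g b d) 0.
  have [->|bd] := eqVneq (br b d) 0; first by rewrite br0l; apply: submod0.
  have Ee := nbr_ext (special_nbr Eb Ed gbd bd).
  have Ge : gr 0 (br b d) by exact: (grb Gb Gd).
  have -> : br (br b d) c = expz (br b d) c - c.
    by rewrite /expz (orth Ge Gc) //; lmodring.
  apply: (submodB SS) => //; apply: span_gen; split; last exact/isom_ext/Ec/expz_isom.
  by rewrite /expz (orth Ge Gc) // scale0r addr0; apply: grD => //; exact: (grb Ge Gc).
have [d' Ed'] : exists d', d' = (g b d)^-1 *: d by eexists.
have {Ed} Exd : ext d' by rewrite Ed'; apply: extZ.
have {Gd} Gd : gr (-1) d' by rewrite Ed'; apply: grZ.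
have gdb : g d' b = 1 by rewrite Ed' gZl (gC d) mulVf.
have -> : br (br b d) c = g b d *: br (br b d') c.
  by rewrite Ed' brZr brZl scalerA mulfV // scale1r.
apply: (submodZ SS) => {Ed' gbd d}.
have gbc : g b c = 0 by exact: (orth Gb Gc).
have [om Hom] : gr 2 (br b c) by exact: (grb Gb Gc).
have Gh : gr 0 (br b d') by exact: (grb Gb Gd).
have Syd : S (br y d').
  by apply: span_gen; split; [exact: (gr_br_y Ex Ey gxy)|by apply: (@ext_br_y x y)].
have Sb : S b by apply: span_gen.
(* In the grading of [d'], [b] the component of [c] of degree -2 vanishes because [g b c = 0]; those
   of degree -1 and 2 are multiples of [br y d'] and [b], both in [S]. The triple bracket is
   expressed by these and the component of degree 1. *)
have cn1 : pr d' b (-1) c = om *: br y d'.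
  rewrite prT /= /pdn Hom gbc (brC d') -(brC d') (brC d' b) gNl (orth Gh Gc) //.
  by rewrite brZr (brC d' y); lmodring.
have c1 : pr d' b 1 c = - br b (br d' c) - (g d' c *+ 2) *: b.
  by rewrite prT /= /pdn (orth Gh Gc) //; lmodring.
have S1 : S (pr d' b 1 c).
  (* The torus image of [c] is extremal and still of degree 1 for [x], [y]. Its difference from [c]
     contains the wanted component with coefficient [l - 1], which is invertible, next to elements
     of [S]. *)
  have [l [l0 l1]] := large.
  have El := isom_ext (torus_isom Exd Eb gdb l0) Ec.
  have tE : torus d' b l c =
      c + (l^-1 - 1) *: pr d' b (-1) c + (l - 1) *: pr d' b 1 c + (l ^+ 2 - 1) *: pr d' b 2 c.
    rewrite {2}[c](pr_sum d' b) torusT /torus_def.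
    have -> : pr d' b (-2) c = 0 by rewrite prT /= gbc scale0r.
    by rewrite (_ : l ^ (-1) = l^-1) //; lmodring.
  have Gn1 : gr 1 (pr d' b (-1) c) by rewrite cn1; apply/grZ/spanE1_gr.
  have G1 : gr 1 (pr d' b 1 c).
    rewrite c1; apply: grD; apply: grN; last exact: grZ.
    exact: (grb Gb (grb Gd Gc)).
  have c2 : pr d' b 2 c = g d' c *: b by rewrite prT.
  have St : S (torus d' b l c).
    apply: span_gen; split=> //; rewrite tE c2.
    by apply: grD; [apply: grD; [apply: grD|]|] => //; apply: grZ => //; apply: grZ.
  have -> : pr d' b 1 c = (l - 1)^-1 *: (torus d' b l c - c - (l^-1 - 1) *: pr d' b (-1) c
     - (l ^+ 2 - 1) *: pr d' b 2 c).
    rewrite tE; apply: (scalerI (_ : l - 1 != 0)); first by rewrite subr_eq0.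
    by rewrite scalerA mulfV ?subr_eq0 // scale1r; lmodring.
  apply: (submodZ SS); apply: (submodB SS); first apply: (submodB SS); first apply: (submodB SS) => //.
    by apply: (submodZ SS); rewrite cn1; apply: (submodZ SS).
  by apply: (submodZ SS); rewrite c2; apply: (submodZ SS).
have -> : br (br b d') c = - pr d' b 1 c - (g d' c *+ 2) *: b + om *: br y d'.
  have -> : br (br b d') c = br b (br d' c) - br d' (br b c) by rewrite (brJ b); lmodring.
  by rewrite Hom c1 brZr (brC d' y); lmodring.
apply: (submodD SS); last exact: (submodZ SS).
by apply: (submodB SS); [exact: (submodN SS)|exact: (submodZ SS)].
Qed.

Lemma normE1_br s s' : S s -> spanE1 y x s' -> normE1 x y (br s s').
Proof.
move=> Hs Hs'; apply: (Hs' _ (br_submod s (normE1_submod x y))).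
move=> d [/grade_swap Gd Ed]; apply: (Hs _ (brl_submod d (normE1_submod x y))).
move=> b [Gb Eb] t Ht; apply: (Ht _ (br_submod (br b d) SS)).
by move=> c [Gc Ec]; apply: spanE1_triple.
Qed.

Lemma normE1_h : normE1 x y (br x y).
Proof. by move=> s Ss; rewrite (br_hu Ex Ey gxy) //; apply: spanE1_gr. Qed.

Lemma normE1_brN u w : normE1 x y u -> normE1 x y w -> normE1 x y (br u w).
Proof.
move=> Hu Hw s Ss; have -> : br (br u w) s = br u (br w s) - br w (br u s).
  by rewrite (brJ u); lmodring.
by apply: (submodB SS); [apply: Hu; apply: Hw|apply: Hw; apply: Hu].
Qed.

Lemma spanE1_pr_br u w : subE1 x y u -> subE1 x y w -> S (pr x y 1 (br u w)).
Proof.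
move=> [u1 un1 u0 _] [w1 wn1 w0 _]; rewrite (pr_br Ex Ey gxy).
rewrite (@pr_range x y (1 + 2)) // br0r add0r.
apply: (submodD SS); first apply: (submodD SS); first apply: (submodD SS).
- have -> : pr x y (1 + 1) w = g x w *: y by rewrite prT.
  by rewrite brZr brC; apply: (submodZ SS); apply: (submodN SS); apply: spanE1_br_y.
- exact: u0.
- by rewrite brC; apply: (submodN SS); apply: w0.
- have -> : pr x y 2 u = g x u *: y by rewrite prT.
  by rewrite brZl; apply: (submodZ SS); apply: spanE1_br_y.
Qed.

Lemma normE1_pr_br u w : subE1 x y u -> subE1 x y w -> normE1 x y (pr x y 0 (br u w)).
Proof.
move=> [u1 un1 u0 _] [w1 wn1 w0 _]; rewrite (pr_br Ex Ey gxy).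
have NS := normE1_submod x y.
have p2 m : pr x y 2 m = g x m *: y by rewrite prT.
have pn2 m : pr x y (-2) m = g y m *: x by rewrite prT.
apply: (submodD NS); first apply: (submodD NS); first apply: (submodD NS);
  first apply: (submodD NS).
- rewrite (p2 w : pr x y (0 + 2) w = _) pn2 brZl brZr; do 2!apply: (submodZ NS).
  exact: normE1_h.
- by rewrite brC; apply: (submodN NS); apply: normE1_br.
- exact: normE1_brN.
- exact: normE1_br.
- rewrite (pn2 w : pr x y (0 - 2) w = _) p2 brZl brZr brC; do 2!apply: (submodZ NS).
  by apply: (submodN NS); apply: normE1_h.
Qed.

End SpanHalf.

Section SpanAll.
Variables x y : V.
Hypotheses (Ex : ext x) (Ey : ext y) (gxy : g x y = 1).
Let gyx : g y x = 1. Proof. by rewrite gC. Qed.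
Local Notation gr := (grade br g x y).
Local Notation W := (subE1 x y).
Let SW : submod W := subE1_submod x y.
Let grb := gr_br Ex Ey gxy.
Let orth := g_orth Ex Ey gxy.
Let y0 : y != 0.
Proof. by apply/eqP => e; move: gxy; rewrite e g0r => /esym/eqP; rewrite oner_eq0. Qed.

Lemma subE1_br u w : W u -> W w -> W (br u w).
Proof.
move=> Wu Ww; split.
- exact: spanE1_pr_br.
- by rewrite pr_swap; apply: spanE1_pr_br => //; apply: subE1_swap.
- exact: normE1_pr_br.
- rewrite (pr_swap y x 0 _ : pr x y 0 _ = pr y x 0 _).
  by apply: normE1_pr_br => //; apply: subE1_swap.
Qed.

Lemma subE1_gr i m : gr i m -> i != 0 -> (i = 1 -> spanE1 x y m) -> (i = -1 -> spanE1 y x m) -> W m.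
Proof.
move=> Gm i0 H1 H2.
have p j : pr x y j m = if j == i then m else 0 by apply: pr_of_gr.
have S0 := submod0 (spanE1_submod x y); have S0' := submod0 (spanE1_submod y x).
have N0 := submod0 (normE1_submod x y); have N0' := submod0 (normE1_submod y x).
split; rewrite p ?[0 == i]eq_sym ?(negPf i0) //.
  by case: eqP => // /esym/H1.
by case: eqP => // /esym/H2.
Qed.

Lemma subE1_ext1 b : gr 1 b -> ext b -> W b.
Proof. by move=> Gb Eb; apply: (subE1_gr Gb) => // _; apply: span_gen. Qed.
Lemma subE1_y : W y. Proof. by apply: (subE1_gr (gr_y x y)). Qed.
Lemma subE1_x : W x. Proof. by apply: (subE1_gr (gr_x x y)). Qed.

Lemma subE1_expz u m : W u -> W m -> W (expz u m).
Proof.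
move=> Wu Wm; rewrite /expz; apply: (submodD SW); last exact: (submodZ SW).
by apply: (submodD SW) => //; apply: subE1_br.
Qed.

(** * The orbit of [y] under the isometries preserving [W] *)

Definition reach (e : V) : Prop := exists th c,
  [/\ isom th, forall m, W m -> W (th m), c != 0 & th y = c *: e].

Lemma reach_sub e : reach e -> ext e /\ W e.
Proof.
move=> [th [c [I Wth c0 E]]].
have -> : e = c^-1 *: th y by rewrite E scalerA mulVf // scale1r.
by split; [apply/extZ/isom_ext|apply/(submodZ SW)/Wth/subE1_y].
Qed.

Lemma reach_neq0 e : reach e -> e != 0.
Proof.
move=> [th [c [I Wth c0 E]]]; apply: contraNneq y0 => e0; case: (I) => _ b _ _.
by apply/eqP/(bij_inj b); rewrite E e0 scaler0 (isom0 I).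
Qed.

Lemma reach_isom th e : isom th -> (forall m, W m -> W (th m)) -> reach e -> reach (th e).
Proof.
move=> I Wth [th' [c [I' Wth' c0 E]]]; exists (th \o th'), c; split=> //.
- exact: isom_comp.
- by move=> m Wm; apply/Wth/Wth'.
- by rewrite /= E (isomZ I).
Qed.

Lemma reachZ a e : a != 0 -> reach (a *: e) -> reach e.
Proof.
move=> a0 [th [c [I Wth c0 E]]]; exists th, (c * a); split=> //; first by rewrite mulf_neq0.
by rewrite E scalerA.
Qed.

Lemma reach_opp v o : ext v -> W v -> reach o -> g v o != 0 -> reach v.
Proof.
move=> Ev Wv Ro vo; have [Eo Wo] := reach_sub Ro.
have [th [c [I c0 E H]]] := opp_isom Ev Eo vo.
apply: (reachZ c0); rewrite -E; apply: reach_isom => //; apply: H => //.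
  by move=> u _ Wu m Wm; apply: subE1_expz.
by move=> a u; apply: submodZ.
Qed.

Lemma reach_y : reach y.
Proof.
exists id, 1; rewrite oner_neq0 scale1r; split=> //; split=> //.
by exists id.
Qed.

Lemma reach_x : reach x.
Proof. by apply: (reach_opp Ex subE1_x reach_y); rewrite gxy oner_neq0. Qed.

(* [expz (s *: br x b)] fixes [b] and moves [y] to [y + s *: b], so an element
   opposite [b] can be moved to one that is opposite [b] but not [y]. *)
Lemma opp_gr1 b : gr 1 b -> ext b -> b != 0 -> exists d, [/\ gr (-1) d, ext d & g b d != 0].
Proof.
move=> Gb Eb b0; have [z [Ez gbz]] := opp_ex b0.
pose s := g z y; pose z' := expz (s *: br x b) z.
have Ed : ext (br x b) by apply: (ext_br_x Ex Ey gxy).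
have Gd : gr (-1) (br x b) by exact: (grb (gr_x x y) Gb).
have Is := expz_isom (extZ s Ed); have [_ _ _ gs] := Is.
have Ez' : ext z' by apply: isom_ext.
have fixb : expz (s *: br x b) b = b.
  apply: expz_fix; last by rewrite gZl gA brvv g0r mulr0.
  by rewrite brZl brC (brC x b) brNr opprK ext1 // (orth Gb (gr_x x y)) // mul0rn scale0r scaler0.
have gz'b : g z' b = 1 by rewrite -{1}fixb gs gC.
have gyz' : g y z' = 0.
  have -> : y = expz (s *: br x b) (y - s *: b).
    by rewrite (isomD Is) (isomN Is) (isomZ Is) fixb (expz_xb Ex Ey gxy) //; lmodring.
  by rewrite gs !gE gbz gC -/s; ring.
have Fz : Fil x y (-1) z'.
  move=> i lt; have [->|ne] := eqVneq i (-2); first by rewrite prT /= gyz' scale0r.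
  by rewrite pr_range //; apply/orP; left; lia.
exists (pr x y (-1) z'); split; [exact: gr_pr|exact: (ext_low Ex Ey gxy Ez' Fz)|].
by have := g_pr Ex Ey gxy z' Gb; rewrite gz'b gC => <-; apply: oner_neq0.
Qed.

(** Write the neighbour as [b + c *: y]. For nonzero [c] it is opposite [x]. For [c = 0] it is
    opposite [x + d], the image of [x] under the exponential of [br y d], where [d] is opposite
    [b]. *)
Lemma reach_nbr_y f : nbr y f -> reach f.
Proof.
move=> /(nbr_frame Ex Ey gxy) [b [c [-> Gb b0 Eb]]].
have Ef : ext (b + c *: y) by apply: (ext_line Ex Ey gxy).
have Wb := subE1_ext1 Gb Eb.
have Wf : W (b + c *: y) by apply: (submodD SW) => //; apply/(submodZ SW)/subE1_y.
have [c0|c0] := eqVneq c 0; last first.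
  by apply: (reach_opp Ef Wf reach_x); rewrite gDl gZl gyx mulr1 (orth Gb (gr_x x y)) // add0r.
have [d [Gd Ed gbd]] := opp_gr1 Gb Eb b0.
have Gu : gr 1 (br y d) by exact: (gr_br_y Ex Ey gxy).
have Eu : ext (br y d) by apply: (@ext_br_y x y).
have Wu := subE1_ext1 Gu Eu; have I := expz_isom Eu.
apply: (reach_opp Ef Wf (reach_isom I _ reach_x)); first by move=> m; apply: subE1_expz.
rewrite c0 scale0r addr0 /expz (orth Gu (gr_x x y)) // scale0r addr0 gDr (orth Gb (gr_x x y)) //.
by rewrite add0r brC (br_xyd Ex Ey gxy) // opprK.
Qed.

Lemma reach_nbr e f : reach e -> nbr e f -> reach f.
Proof.
move=> [th [c [I Wth c0 E]]] nef.
have [th' Kth Kth'] : exists2 th', cancel th th' & cancel th' th.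
  by case: (I) => _ [th' ? ?] _ _; exists th'.
have I' := isom_inv I Kth Kth'.
rewrite -(Kth' f); apply: reach_isom => //; apply: reach_nbr_y.
rewrite -(Kth y) E; have := nbr_isom I' nef.
have -> : th' e = c^-1 *: th' (c *: e) by rewrite (isomZ I') scalerA mulVf // scale1r.
by apply: nbr_scale; rewrite invr_eq0.
Qed.

(** The path from [e] through [br e z] to [z] joins neighbours, since being special is symmetric in
    the pair. *)
Lemma reach_special e z : reach e -> ext z -> g e z = 0 -> br e z != 0 -> reach z.
Proof.
move=> Re Ez gez ez; have [Ee We] := reach_sub Re.
have nf := special_nbr Ee Ez gez ez.
apply: (reach_nbr (reach_nbr Re nf)).
have N1 : (-1 : R) != 0 by rewrite oppr_eq0 oner_neq0.
apply: (nbr_scale N1); rewrite scaleN1r -brC.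
have ze : br z e != 0 by rewrite brC oppr_eq0.
apply: nbr_sym => //; first exact: br_neq0l ze.
by apply: special_nbr; rewrite // gC.
Qed.

(** [reach_opp] asks for [W z], which is unknown here. Instead, a neighbour [f] of [e] is moved
    along its line until it is orthogonal to [z]; the pair [f], [z] is then special. *)
Lemma reach_all_opp e z : reach e -> ext z -> g e z != 0 -> reach z.
Proof.
move=> Re Ez gez; have [Ee We] := reach_sub Re; have e0 := reach_neq0 Re.
have [f0 nf0] := nbr_ex Ee e0.
have [f [nf gfz]] : exists f, nbr e f /\ g f z = 0.
  exists (f0 + (- (g f0 z / g e z)) *: e); split; first exact: nbr_line.
  by rewrite gDl gZl mulNr divfK // subrr.
apply: (reach_special (reach_nbr Re nf)) => //; apply/eqP => fz.
(* If [f = br e m] commuted with [z], the third identity for [e] would make [g e z *: f] a multiple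
   of [e]. *)
case: (nf) => _ nmul [m [gm fE]]; apply: nmul; exists ((g e z)^-1 * g e (br z m)).
have := ext3 z m Ee; rewrite -fE (brC z f) fz oppr0 br0r gm scale0r subr0 => /esym/eqP.
by rewrite subr_eq0 => /eqP E; apply: (scalerI gez); rewrite -E scalerA mulVKf.
Qed.

Lemma reach_ext z : ext z -> z != 0 -> reach z.
Proof.
move=> Ez z0; apply: contrapT => nR.
have comm v : ext v -> ~ reach v -> forall e, reach e -> br e v = 0.
  move=> Ev nRv e Re; apply/eqP; apply: contrapT => /negP ev; apply: nRv.
  by have [gev|gev] := eqVneq (g e v) 0; [apply: (reach_special Re)|apply: (reach_all_opp Re)].
have SR := span_submod reach.
case/eqP: z0; apply: center0 => m; rewrite brC; apply/eqP; rewrite oppr_eq0; apply/eqP.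
apply: (@span_ideal reach y reach_y y0 _ m (fun m => br m z = 0)); last 1 first.
- by move=> e Re; apply: comm.
(* Either [v] commutes with the orbit, or [v] lies in [W] and [expz v] preserves [W], hence the
   orbit. *)
- move=> v w Ev Rw; have [Rv|nRv] := EM (reach v); last first.
    by rewrite brC (comm v) // oppr0; apply: submod0.
  have [_ Wv] := reach_sub Rv.
  have -> : br v w = expz v w - w - g v w *: v by rewrite /expz; lmodring.
  apply: (submodB SR); last by apply: (submodZ SR); apply: span_gen.
  apply: (submodB SR); apply: span_gen => //; apply: reach_isom => //; first exact: expz_isom.
  by move=> u; apply: subE1_expz.
- by split=> [|a u v Hu Hv]; rewrite !brE // Hu Hv scaler0 addr0.
Qed.

Theorem gr1_span m : gr 1 m -> spanE1 x y m.
Proof.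
move=> Gm; rewrite -(pr_id Ex Ey gxy Gm).
suff /(_ m) [] : forall v, W v by [].
apply: (subalg_all SW); first by move=> *; apply: subE1_br.
move=> z Ez; have [->|z0] := eqVneq z 0; first exact: submod0.
by case: (reach_sub (reach_ext Ez z0)).
Qed.

End SpanAll.

(** By the third identity the difference [D] of [f] and [g z] satisfies [D [u,v] z = D(v) [z,u] +
    D(u) [z,v]]. Take a neighbour [e = [z,m]]. Once [D(m) = 0], the case [u = m] makes [D(v) e] a
    multiple of [z], so [D(v) = 0]. *)
Lemma ext_form_unique z f : ext z -> z != 0 -> extremal_with br f z -> forall v, f v = g z v.
Proof.
move=> Ez z0 [_ Ef].
have dE u v : (f (br u v) - g z (br u v)) *: z =
    (f v - g z v) *: br z u + (f u - g z u) *: br z v.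
  have [_ _ E] := Ef u v; have := ext3 u v Ez; rewrite {}E => E.
  by apply: (eq_by_diff E); lmodring.
have [w [Ew gw]] := frame_ex z0; have [e ne] := nbr_ex Ez z0.
have [b [c [eE Gb b0 _]]] := nbr_frame Ew Ez gw ne.
have [_ nmul [m [gm em]]] := ne.
have h0 : br w z != 0.
  by apply: contraNneq b0 => h0; rewrite -(br_hu Ew Ez gw Gb) h0 br0l.
(* This is the degree 0 part of the identity for [m] and [w]: [z] and [br z m] have only positive
   components, while [br z w] is nonzero of degree 0. *)
have dm : f m - g z m = 0.
  have := congr1 (pr w z 0) (dE m w); rewrite -em eE (brC z w).
  rewrite !(prZ, prD, prN) (pr_of_gr Ew Ez gw 0 (gr_y w z)) (pr_of_gr Ew Ez gw 0 Gb).
  rewrite (pr_id Ew Ez gw (gr_h Ew Ez gw)) !scaler0 addr0 scaler0 add0r => /esym/eqP.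
  by rewrite scaler_eq0 oppr_eq0 (negPf h0) orbF => /eqP.
move=> v; apply/eqP; rewrite -subr_eq0; apply: contrapT => /negP dv.
apply: nmul; exists ((f v - g z v)^-1 * (f (br m v) - g z (br m v))).
by apply: (scalerI dv); rewrite scalerA mulVKf // dE dm -em scale0r addr0.
Qed.

End Geometry.

Lemma isom_expz th z m : isom th -> th (expz z m) = expz (th z) (th m).
Proof. by move=> I; case: (I) => _ _ h gg; rewrite /expz !(isomE I) h gg. Qed.

(** * Products of exponentials *)

Definition prodexp (t : seq V) : V -> V := foldr (fun f a => expz f \o a) id t.

Section Exponential.
Variables x y : V.
Hypotheses (Ex : ext x) (Ey : ext y) (gxy : g x y = 1).
Let gyx : g y x = 1. Proof. by rewrite gC. Qed.
Local Notation gr := (grade br g x y).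
Let grb := gr_br Ex Ey gxy.
Let orth := g_orth Ex Ey gxy.
Let E1 f := gr 1 f /\ ext f.

Lemma isom_id : isom id. Proof. by split=> //; exists id. Qed.

Lemma prodexp_isom t : (forall f, f \in t -> ext f) -> isom (prodexp t).
Proof.
elim: t => [|f t IH] H /=; first exact: isom_id.
apply: isom_comp; first by apply/expz_isom/H; rewrite mem_head.
by apply: IH => e te; apply: H; rewrite in_cons te orbT.
Qed.

Lemma expzD a b m : expz (a *: y) (expz (b *: y) m) = expz ((a + b) *: y) m.
Proof.
rewrite /expz !brE !gE ext1 // gzb (ext_gzz Ey); lmodring.
Qed.

Lemma expz_fix_y f : gr 1 f -> expz f y = y.
Proof.
move=> Gf; have fy : br f y = 0 by exact: (grb Gf (gr_y x y)).
by apply: expz_fix => //; apply: (orth Gf (gr_y x y)).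
Qed.

(** This is half of the polarized first identity, and exactly the cross term needed in [expz_line].
    As [f = br y (- br x f)], it is an instance of the third identity for [y]. *)
Lemma br_f_y f m : gr 1 f -> br f (br y m) = g f m *: y + g y m *: f.
Proof.
move=> Gf.
have yf : br y f = 0 by exact: (grb (gr_y x y) Gf).
have -> : br f (br y m) = br y (br f m) by rewrite (brJ y) yf br0l add0r.
have Gd : gr (-1) (br x f) by exact: (grb (gr_x x y) Gf).
have fE : f = br y (- br x f) by rewrite brNr (br_yxu Ex Ey gxy) // opprK.
have yd : g y (- br x f) = 0 by rewrite gNr (orth (gr_y x y) Gd) // oppr0.
rewrite {1}fE (brC (br y _)) brNr ext3 // yd -fE (brC m) gNr -gA -fE.
by rewrite opprB; lmodring.
Qed.

Lemma expz_line f c m : gr 1 f -> expz (f + c *: y) m = expz f (expz (c *: y) m).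
Proof.
move=> Gf; have fy := br_f_y m Gf.
rewrite /expz !brE !gE fy.
have -> : br f y = 0 by exact: (grb Gf (gr_y x y)).
have -> : g f y = 0 by exact: (orth Gf (gr_y x y)).
have -> : g f (br y m) = 0 by rewrite -gA (grb Gf (gr_y x y) : br f y = 0) g0l.
by lmodring.
Qed.

Lemma expz_y_comm c f m : E1 f -> expz f (expz (c *: y) m) = expz (c *: y) (expz f m).
Proof.
move=> [Gf Ef]; have I := expz_isom Ef.
by rewrite (isom_expz _ _ I) (isomZ I) expz_fix_y.
Qed.

(** Conjugation by [expz f] turns [expz f'] into the exponential of [expz f f' = f' + c *: y], where
    [br f f' = c *: y]. *)
Lemma expz_comm f f' : E1 f -> E1 f' ->
  exists c, forall m, expz f (expz f' m) = expz f' (expz f (expz (c *: y) m)).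
Proof.
move=> [Gf Ef] [Gf' Ef']; have [c Hc] : gr 2 (br f f') by exact: (grb Gf Gf').
exists c => m; rewrite expz_y_comm // -expz_line //.
rewrite (isom_expz _ _ (expz_isom Ef)); congr (expz _ _).
by rewrite /expz Hc (orth Gf Gf') // scale0r addr0.
Qed.

Lemma prodexp_y_comm t c m : (forall f, f \in t -> E1 f) ->
  prodexp t (expz (c *: y) m) = expz (c *: y) (prodexp t m).
Proof.
elim: t => [|f t IH] H //=; rewrite IH; last by move=> e te; apply: H; rewrite in_cons te orbT.
by rewrite expz_y_comm //; apply: H; rewrite mem_head.
Qed.

Lemma prodexp_front s1 f s2 : (forall e, e \in s1 ++ f :: s2 -> E1 e) ->
  exists c, forall m, prodexp (s1 ++ f :: s2) m = prodexp (f :: s1 ++ s2) (expz (c *: y) m).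
Proof.
elim: s1 => [|e s1 IH] H.
  by exists 0 => m; rewrite scale0r /expz br0l g0l scale0r !addr0.
have He : E1 e by apply: H; rewrite mem_head.
have Hf : E1 f by apply: H; rewrite mem_cat mem_head orbT.
have [|c Hc] := IH; first by move=> e' te; apply: H; rewrite in_cons te orbT.
have [d Hd] := expz_comm He Hf.
exists (d + c) => m; rewrite /= Hc /= Hd; congr (expz f (expz e _)).
rewrite -prodexp_y_comm ?expzD // => e' te; apply: H.
by rewrite in_cons mem_cat in_cons; move: te; rewrite mem_cat => /orP [] ->; rewrite ?orbT.
Qed.

Lemma prodexp_perm t t' : (forall f, f \in t -> E1 f) -> perm_eq t t' ->
  exists c, forall m, prodexp t m = prodexp t' (expz (c *: y) m).
Proof.
elim: t t' => [|f t IH] t' H.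
  rewrite perm_sym => /perm_nilP ->.
  by exists 0 => m; rewrite scale0r /expz br0l g0l scale0r !addr0.
move=> p; have H' e : e \in t' -> E1 e by move=> te; apply: H; rewrite (perm_mem p).
have ft : f \in t' by rewrite -(perm_mem p) mem_head.
case/splitPr: ft p H' => s1 s2 p H'.
have {}p : perm_eq t (s1 ++ s2).
  by rewrite -(perm_cons f) (perm_trans p) // -cat1s perm_catCA.
have [|c Hc] := IH _ _ p; first by move=> e te; apply: H; rewrite in_cons te orbT.
have [d Hd] := prodexp_front H'.
exists (c - d) => m; rewrite Hd expzD addrC subrK.
by rewrite /= Hc.
Qed.

(* The defining property of an [l]-exponential automorphism, up to the sizes of
   the higher terms. *)
Definition expo (l : V) (al : V -> V) : Prop :=
  forall n m, Fil x y n m -> Fil x y (n + 2) (al m - m - br l m).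

Lemma expo_id : expo 0 id.
Proof. by move=> n m _; rewrite br0l !subrr; apply: Fil0. Qed.

Lemma expo_comp l l' al al' : gr 1 l -> gr 1 l' -> expo l al -> expo l' al' ->
  expo (l + l') (al \o al').
Proof.
move=> Gl Gl' Hal Hal' n m Fm.
have Fl := Fil_gr Ex Ey gxy Gl (lexx 1); have Fl' := Fil_gr Ex Ey gxy Gl' (lexx 1).
have F' := Hal' n m Fm.
have Fd : Fil x y (n + 1) (al' m - m).
  have -> : al' m - m = al' m - m - br l' m + br l' m by lmodring.
  apply: FilD; first by apply: (Fil_le F'); lia.
  by apply: (Fil_br_le Ex Ey gxy Fl' Fm); lia.
have Fam : Fil x y n (al' m).
  have -> : al' m = al' m - m + m by lmodring.
  by apply: FilD => //; apply: (Fil_le Fd); lia.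
have -> : (al \o al') m - m - br (l + l') m =
  (al (al' m) - al' m - br l (al' m)) + (al' m - m - br l' m) + br l (al' m - m).
  by rewrite /= !brE; lmodring.
apply: FilD; first by apply: FilD => //; apply: Hal.
by apply: (Fil_br_le Ex Ey gxy Fl Fd); lia.
Qed.

Lemma expo_expz f : gr 1 f -> expo f (expz f).
Proof.
move=> Gf n m Fm; have -> : expz f m - m - br f m = g f m *: f by rewrite /expz; lmodring.
(* [g f m] only sees the component of [m] of degree -1. So it vanishes unless [n <= -1], and then
   the degree 1 of [f] is at least [n + 2]. *)
have [lt|ge] := ltP (-1) n.
  have := g_pr Ex Ey gxy m Gf; rewrite Fm // g0l gC => ->.
  by rewrite scale0r; apply: Fil0.
by apply: FilZ; apply: (Fil_gr Ex Ey gxy Gf); lia.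
Qed.

Lemma expo_prodexp t : (forall f, f \in t -> gr 1 f) -> expo (\sum_(f <- t) f) (prodexp t).
Proof.
elim: t => [|f t IH] H; first by rewrite big_nil; apply: expo_id.
have Ht e : e \in t -> gr 1 e by move=> te; apply: H; rewrite in_cons te orbT.
have Gf : gr 1 f by apply: H; rewrite mem_head.
rewrite big_cons; apply: expo_comp => //; last exact: IH; last exact: expo_expz.
rewrite big_seq; elim/big_ind: _ => //; [exact: gr0|exact: grD].
Qed.

Lemma expo_y l al c : gr 1 l -> expo l al -> expo l (al \o expz (c *: y)).
Proof.
move=> Gl Hal n m Fm; have -> : (al \o expz (c *: y)) m - m - br l m = (al (expz (c *: y) m) - expz (c *: y) m - br l (expz (c *: y) m)) + (expz (c *: y) m - m) + br l (expz (c *: y) m - m).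
  by rewrite /= !brE; lmodring.
have Gc : gr 2 (c *: y) by apply/grZ/gr_y.
have Fc := Fil_gr Ex Ey gxy Gc (lexx 2).
have Fd : Fil x y (n + 2) (expz (c *: y) m - m).
  have -> : expz (c *: y) m - m = br (c *: y) m + g (c *: y) m *: (c *: y) by rewrite /expz; lmodring.
  apply: FilD; first by apply: (Fil_br_le Ex Ey gxy Fc Fm); lia.
  have [lt|ge] := ltP (-2) n.
    have := g_pr Ex Ey gxy m Gc; rewrite Fm // g0l gC => ->.
    by rewrite scale0r; apply: Fil0.
  by apply: FilZ; apply: (Fil_le Fc); lia.
have Fm' : Fil x y n (expz (c *: y) m).
  have -> : expz (c *: y) m = expz (c *: y) m - m + m by lmodring.
  by apply: FilD => //; apply: (Fil_le Fd); lia.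
apply: FilD; first by apply: FilD => //; apply: Hal.
by apply: (Fil_br_le Ex Ey gxy (Fil_gr Ex Ey gxy Gl (lexx 1)) Fd); lia.
Qed.


(** [Q k] collects the part of [al] that raises degrees by [k]. On degree [i >= -2] the remainder
    [al m - m - br l m] has components only from [i + 2] to 2, so [k = 2, 3, 4] exhaust it. *)
Lemma expo_grade l al : (forall a u v, al (a *: u + v) = a *: al u + al v) ->
  gr 1 l -> expo l al ->
  exists q n v : V -> V,
  [/\ forall i m, gr i m -> gr (i + 2) (q m), forall i m, gr i m -> gr (i + 3) (n m),
      forall i m, gr i m -> gr (i + 4) (v m) & forall m, al m = m + br l m + q m + n m + v m].
Proof.
move=> lin Gl H.
have aD u w : al (u + w) = al u + al w by have := lin 1 u w; rewrite !scale1r.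
have a0 : al 0 = 0.
  by have /(congr1 (fun z => z - al 0)) := aD 0 0; rewrite addr0 addrK subrr.
have [Q QE] : exists Q : int -> V -> V, forall k m, Q k m =
    pr x y (-2 + k) (al (pr x y (-2) m)) + pr x y (-1 + k) (al (pr x y (-1) m)) +
    pr x y (0 + k) (al (pr x y 0 m)) + pr x y (1 + k) (al (pr x y 1 m)) +
    pr x y (2 + k) (al (pr x y 2 m)) by eexists.
have prg := pr_of_gr Ex Ey gxy.
have Qg i k m : gr i m -> Q k m = pr x y (i + k) (al m).
  move=> Gm; rewrite QE !(prg _ _ _ Gm).
  case: i Gm => [[|[|[|n]]]|[|[|n]]] Gm; rewrite /= ?a0 ?pr0r ?(addr0, add0r) //.
  - by rewrite Gm a0 pr0r.
  - by rewrite Gm a0 pr0r.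
have QD k u w : Q k (u + w) = Q k u + Q k w.
  by rewrite !QE !(prD, aD); lmodring.
have Qgr k i m : gr i m -> gr (i + k) (Q k m).
  by move=> Gm; rewrite (Qg i) //; apply: gr_pr.
exists (Q 2), (Q 3), (Q 4); split; [exact: Qgr..|].
apply: (@gr_ind x y Ex Ey gxy _) => [u w Hu Hw|i m Gm].
  by rewrite aD {}Hu {}Hw !QD brDr; lmodring.
have [d dE] : exists d, d = al m - m - br l m by eexists.
have Fd : Fil x y (i + 2) d by rewrite dE; apply: H; apply: (Fil_gr Ex Ey gxy Gm).
have Qd k : 2 <= k -> Q k m = pr x y (i + k) d.
  move=> k2; rewrite (Qg i) // dE !(prD, prN) (prg _ _ _ Gm) (prg _ _ _ (grb Gl Gm)).
  have -> : (i + k == i) = false by apply/eqP; lia.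
  have -> : (i + k == 1 + i) = false by apply/eqP; lia.
  by lmodring.
have -> : al m = m + br l m + d by rewrite dE; lmodring.
rewrite -!addrA; do 2!congr (_ + _); rewrite !Qd //.
have [i3|i3] := boolP ((i < -2) || (2 < i)).
  have m0 : m = 0 by rewrite -(pr_id Ex Ey gxy Gm) pr_range.
  by rewrite dE m0 a0 br0r !subr0 !pr0r !addr0.
have z j : j < i + 2 -> pr x y j d = 0 by apply: Fd.
have r j : 2 < j -> pr x y j d = 0 by move=> j2; rewrite pr_range // j2 orbT.
rewrite {1}[d](pr_sum x y).
have : i = -2 \/ i = -1 \/ i = 0 \/ i = 1 \/ i = 2 by move: i3; lia.
case=> [e|[e|[e|[e|e]]]]; move: z; rewrite e => z.
- rewrite (z (-2)) // (z (-1)) //; lmodring.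
- rewrite (z (-2)) // (z (-1)) // (z 0) // (r (-1 + 4)) //; lmodring.
- rewrite (z (-2)) // (z (-1)) // (z 0) // (z 1) // (r (0 + 4)) // (r (0 + 3)) //; lmodring.
- rewrite (z (-2)) // (z (-1)) // (z 0) // (z 1) // (z 2) //.
  rewrite (r (1 + 4)) // (r (1 + 3)) // (r (1 + 2)) //; lmodring.
- rewrite (z (-2)) // (z (-1)) // (z 0) // (z 1) // (z 2) //.
  rewrite (r (2 + 4)) // (r (2 + 3)) // (r (2 + 2)) //; lmodring.
Qed.

End Exponential.
End LieForm.

(** * Galois descent *)

Lemma finite_roots (K : fieldType) (p : {poly K}) : p != 0 ->
  exists r : seq K, forall a, root p a -> a \in r.
Proof.
elim: {p}(size p) {-2}p (leqnn (size p)) => [|n IH] p.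
  by rewrite leqn0 size_poly_eq0 => ->.
move=> sp p0; have [[a ra]|nr] := EM (exists a, root p a); last first.
  by exists [::] => a ra; case: nr; exists a.
have /factor_theorem [q qE] := ra.
have q0 : q != 0 by apply: contraNneq p0 => q0; rewrite qE q0 mul0r.
have [|//|r Hr] := IH q.
  by move: sp; rewrite qE size_Mmonic ?monicXsubC // size_XsubC addn2.
exists (a :: r) => b; rewrite qE rootM root_XsubC in_cons => /orP [/Hr ->|->//].
by rewrite orbT.
Qed.

(** * Elements of trace 1 in a possibly infinite Galois extension *)

Section Trace.
Variables (k k' : fieldType) (s : {rmorphism k -> k'}).
Hypothesis galois : galois_ext s.

Definition gal (t : {rmorphism k' -> k'}) : Prop := bijective t /\ forall c, t (s c) = s c.

Lemma gal_comp (t u : {rmorphism k' -> k'}) : gal t -> gal u -> gal (t \o u).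
Proof. by move=> [bt ft] [bu fu]; split; [exact: bij_comp|move=> c /=; rewrite fu ft]. Qed.

Lemma gal_fixed a : (forall t, gal t -> t a = a) -> exists c, a = s c.
Proof. by move=> H; apply: galois.2 => t bt ft; apply: H. Qed.

(* Dedekind's independence of characters, for characters restricted to a set
   closed under multiplication that separates them. *)
Lemma dedekind (K : k' -> Prop) (n : nat) (sg : 'I_n -> {rmorphism k' -> k'}) (a : 'I_n -> k') :
  K 1 -> (forall c d, K c -> K d -> K (c * d)) ->
  (forall i j, (forall c, K c -> sg i c = sg j c) -> i = j) ->
  (exists i, a i != 0) -> exists2 c, K c & \sum_i a i * sg i c != 0.
Proof.
move=> K1 KM; elim: n => [|n IH] in sg a *; first by move=> _ [[]].
move=> sep [i0 ai0].
apply: contrapT => H.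
have Z c : K c -> \sum_i a i * sg i c = 0.
  by move=> Kc; apply/eqP; apply: contrapT => /negP nz; apply: H; exists c.
have [[j ji0 aj]|nj] := EM (exists2 j, j != i0 & a j != 0); last first.
  move: ai0; have := Z 1 K1; rewrite (bigD1 i0) //= big1 ?addr0 => [|j ji0].
    by rewrite rmorph1 mulr1 => ->; rewrite eqxx.
  have [->|aj] := eqVneq (a j) 0; first by rewrite mul0r.
  by case: nj; exists j.
have [c0 [Kc0 ne]] : exists c, K c /\ sg j c != sg i0 c.
  apply: contrapT => H'; case/eqP: ji0; apply: sep => c Kc; apply/eqP.
  by apply: contrapT => /negP ne; apply: H'; exists c.
have [||c Kc /eqP] := IH (fun i => sg (lift i0 i)) (fun i => a (lift i0 i) * (sg (lift i0 i) c0 - sg i0 c0)).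
- by move=> i i' Hii; apply/(@lift_inj _ i0)/sep.
- case: (unliftP i0 j) ji0 => [j' jE|-> /eqP//] _; exists j'.
  by rewrite -jE mulf_neq0 // subr_eq0.
apply; have := Z _ (KM _ _ Kc0 Kc); have := Z _ Kc.
rewrite !(bigD1_ord i0) //= => E0 E1.
have -> : \sum_i a (lift i0 i) * (sg (lift i0 i) c0 - sg i0 c0) * sg (lift i0 i) c =
  \sum_i a (lift i0 i) * sg (lift i0 i) (c0 * c) - sg i0 c0 * \sum_i a (lift i0 i) * sg (lift i0 i) c.
  by rewrite mulr_sumr -sumrB; apply: eq_bigr => i _; rewrite rmorphM; ring.
apply: (eq_by_diff (u := _ - _) (congr2 (fun u v => u - sg i0 c0 * v) E1 E0)).
by rewrite rmorphM; ring.
Qed.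

Lemma gal_id : gal idfun. Proof. by split=> //; exists id. Qed.

Lemma gal_images (C : seq k') : exists r : seq k',
  forall t c, gal t -> c \in C -> t c \in r.
Proof.
elim: C => [|c C [r Hr]]; first by exists [::].
have [p [p0 rp]] := galois.1 c.
have [|r' Hr'] := @finite_roots k' (map_poly s p); first by rewrite map_poly_eq0.
exists (r' ++ r) => t d gt; rewrite in_cons mem_cat => /orP [/eqP ->|dC].
  rewrite Hr' //; have := rmorph_root t rp; rewrite -map_poly_comp.
  by rewrite (@eq_map_poly _ _ (t \o s) s) // => a /=; rewrite gt.2.
by rewrite Hr ?orbT.
Qed.

(** This replaces a finite Galois group. The elements of [C] have finitely many conjugates, listed
    in [r], so a restriction to [C] is coded by the positions in [r] of the images of [C]. *)
Lemma gal_restrictions (C : seq k') : exists n (sg : 'I_n -> {rmorphism k' -> k'}),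
  [/\ forall i, gal (sg i), forall i j, {in C, sg i =1 sg j} -> i = j &
      forall t, gal t -> exists i, {in C, t =1 sg i}].
Proof.
have [r Hr] := gal_images C.
pose code (t : k' -> k') : {ffun 'I_(size C) -> 'I_(size r).+1} :=
  [ffun i => inord (index (t (tnth (in_tuple C) i)) r)].
have codeP t u : gal t -> gal u -> code t = code u <-> {in C, t =1 u}.
  move=> gt gu; split=> [E c Cc|E].
    have [i ->] : exists i, c = tnth (in_tuple C) i by apply/tnthP.
    have iC := mem_tnth i (in_tuple C).
    have /(congr1 (@nat_of_ord _)) := congr1 (fun f : {ffun _ -> _} => f i) E.
    rewrite !ffunE !inordK ?ltnS ?index_size // => Ei.
    by rewrite -(nth_index 0 (Hr _ _ gt iC)) Ei nth_index // Hr.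
  by apply/ffunP => i; rewrite !ffunE E // mem_tnth.
pose P := [pred f | `[< exists t, gal t /\ code t = f >]].
have /choice [sg Hsg] : forall i : 'I_#|P|, exists t : {rmorphism k' -> k'}, gal t /\ code t = enum_val i.
  by move=> i; have := enum_valP i => /asboolP.
exists #|P|, sg; split=> [i|i j E|t gt]; first by case: (Hsg i).
  by apply: enum_val_inj; rewrite -(Hsg i).2 -(Hsg j).2; apply/codeP => //; apply: (Hsg _).1.
have Pt : code t \in P by apply/asboolP; exists t.
exists (enum_rank_in Pt (code t)); apply/codeP => //; first exact: (Hsg _).1.
by rewrite (Hsg _).2 enum_rankK_in.
Qed.

(** Composition with [t] permutes the restrictions to [C], so the sum over [sg] behaves as a trace
    with values in [k]. Dedekind's lemma gives an element whose trace is nonzero, and dividing by it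
    gives [w]. *)
Lemma trace_one (C : seq k') : exists n (sg : 'I_n -> {rmorphism k' -> k'}) w,
  [/\ forall i, gal (sg i), \sum_i sg i w = 1 &
      forall t, gal t -> exists2 p : 'I_n -> 'I_n, injective p &
        forall i, t (sg i w) = sg (p i) w /\ {in C, forall c, t (sg i c) = sg (p i) c}].
Proof.
have [n [sg [gsg inj ex]]] := gal_restrictions C.
(* The fixed field of the pointwise stabilizer of [C]: here [t \o sg i] and [sg (p i)] agree because
   they agree on [C]. *)
pose K c := forall t u : {rmorphism k' -> k'}, gal t -> gal u -> {in C, t =1 u} -> t c = u c.
have perm t : gal t -> exists2 p : 'I_n -> 'I_n, injective p &
    forall i c, K c -> t (sg i c) = sg (p i) c.
  move=> gt; have /choice [p Hp] : forall i, exists j, {in C, t \o sg i =1 sg j}.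
    by move=> i; apply: (ex (t \o sg i)); apply: gal_comp.
  exists p => [i j pij|i c Kc]; last by apply: (Kc (t \o sg i) (sg (p i)) _ _ (Hp i)) => //; apply: gal_comp.
  apply: inj => c Cc; case: gt => bt _; apply: (bij_inj bt).
  by have := Hp i c Cc; have := Hp j c Cc; rewrite /= pij => -> ->.
have KC c : c \in C -> K c by move=> Cc t u _ _; apply.
have [||||c Kc S0] := @dedekind K n sg (fun=> 1).
- by move=> t u *; rewrite !rmorph1.
- by move=> c d Kc Kd t u gt gu E; rewrite !rmorphM (Kc t u) // (Kd t u).
- by move=> i j H; apply: inj => c Cc; apply/H/KC.
- by have [i _] := ex _ gal_id; exists i; apply: oner_neq0.
have {}S0 : \sum_i sg i c != 0 by under eq_bigr do rewrite -[sg _ c]mul1r.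
have [a aE] : exists a, \sum_i sg i c = s a.
  apply: gal_fixed => t gt; have [p pinj Hp] := perm t gt.
  by rewrite rmorph_sum [RHS](reindex_inj pinj); apply: eq_bigr => i _; apply: Hp.
have Kw : K (c / s a).
  by move=> t u gt gu E; rewrite !fmorph_div gt.2 gu.2 (Kc t u).
exists n, sg, (c / s a); split=> [//||t gt].
  rewrite -[RHS](divff S0) mulr_suml; apply: eq_bigr => i _.
  by rewrite fmorph_div (gsg i).2 aE.
have [p pinj Hp] := perm t gt; exists p => // i; split; first exact: Hp.
by move=> d Cd; apply/Hp/KC.
Qed.

End Trace.

(** * Semilinear maps and fixed vectors of a scalar extension *)

Section ScalarExtension.
Variables (k k' : fieldType) (s : {rmorphism k -> k'}) (L : lmodType k) (brL : L -> L -> L)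
  (M : lmodType k') (brM : M -> M -> M) (iota : L -> M).
Hypothesis SE : scalar_extension s brL brM iota.

Definition comb (t : seq (k' * L)) : M := \sum_(p <- t) p.1 *: iota p.2.

Lemma iotaL a u v : iota (a *: u + v) = s a *: iota u + iota v. Proof. by case: SE. Qed.
Lemma iota0 : iota 0 = 0.
Proof.
by have := iotaL (-1) 0 0; rewrite scaler0 addr0 rmorphN rmorph1 scaleN1r addNr.
Qed.
Lemma iotaD u v : iota (u + v) = iota u + iota v.
Proof. by have := iotaL 1 u v; rewrite rmorph1 !scale1r. Qed.
Lemma iotaZ a u : iota (a *: u) = s a *: iota u.
Proof. by have := iotaL a u 0; rewrite iota0 !addr0. Qed.
Lemma iotaN u : iota (- u) = - iota u.
Proof. by rewrite -scaleN1r iotaZ rmorphN rmorph1 scaleN1r. Qed.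
Lemma iota_br u v : iota (brL u v) = brM (iota u) (iota v). Proof. by case: SE. Qed.
Lemma comb_ex m : exists t, m = comb t. Proof. by case: SE. Qed.
Lemma iota_sum (I : Type) (r : seq I) (F : I -> L) :
  iota (\sum_(i <- r) F i) = \sum_(i <- r) iota (F i).
Proof. by apply: (big_morph iota iotaD iota0). Qed.

Lemma iota_inj : injective iota.
Proof.
move=> u v E; apply/eqP; rewrite -subr_eq0; apply/eqP.
case: SE => _ _ _ /(_ 1%N (fun=> 1) (fun=> u - v)) H; apply: (H _ _ ord0).
  by move=> a; rewrite big_ord1 mulr1 => /eqP; rewrite fmorph_eq0 => /eqP a0 i; rewrite ord1.
by rewrite big_ord1 scale1r iotaD iotaN E subrr.
Qed.

Lemma iota_ind (P : M -> Prop) : P 0 -> (forall u v, P u -> P v -> P (u + v)) ->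
  (forall c l, P (c *: iota l)) -> forall m, P m.
Proof.
move=> P0 PD PZ m; have [t ->] := comb_ex m; rewrite /comb.
by elim/big_ind: _ => // p _; apply: PZ.
Qed.

Section Extend.
Variables (W : lmodType k') (tau : k' -> k') (f : L -> W).
Hypotheses (tauL : forall a c d, tau (s a * c + d) = s a * tau c + tau d)
  (fL : forall a u v, f (a *: u + v) = s a *: f u + f v).

Let tau0 : tau 0 = 0.
Proof. by have := tauL (-1) 0 0; rewrite mulr0 addr0 rmorphN rmorph1 mulN1r addNr. Qed.
Let tauD c d : tau (c + d) = tau c + tau d.
Proof. by have := tauL 1 c d; rewrite rmorph1 !mul1r. Qed.
Let tauZ a c : tau (s a * c) = s a * tau c.
Proof. by have := tauL a c 0; rewrite tau0 !addr0. Qed.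
Let f0 : f 0 = 0.
Proof. by have := fL (-1) 0 0; rewrite scaler0 addr0 rmorphN rmorph1 scaleN1r addNr. Qed.
Let fZ a u : f (a *: u) = s a *: f u.
Proof. by have := fL a u 0; rewrite f0 !addr0. Qed.
Let fD u v : f (u + v) = f u + f v.
Proof. by have := fL 1 u v; rewrite rmorph1 !scale1r. Qed.

(* A linear dependency of the coefficients over [k] shortens the combination;
   if there is none, all the vectors vanish. *)
Let extend0 n (c : 'I_n -> k') (l : 'I_n -> L) :
  \sum_i c i *: iota (l i) = 0 -> \sum_i tau (c i) *: f (l i) = 0.
Proof.
elim: n => [|n IH] in c l *; first by rewrite !big_ord0.
have [ind|] := EM (forall a : 'I_n.+1 -> k, \sum_i s (a i) * c i = 0 -> forall i, a i = 0).
  case: SE => _ _ _ /(_ _ c l ind) H /H l0; apply: big1 => i _.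
  by rewrite l0 f0 scaler0.
move=> /existsNP [a] /not_implyP [aE] /existsNP [j /eqP aj].
pose b i := a (lift j i) / a j.
have cj : c j = - \sum_i s (b i) * c (lift j i).
  have saj : s (a j) != 0 by rewrite fmorph_eq0.
  apply: (mulfI saj); rewrite mulrN mulr_sumr; apply/eqP; rewrite -addr_eq0; apply/eqP.
  rewrite -[RHS]aE [RHS](bigD1_ord j) //=; congr (_ + _); apply: eq_bigr => i _.
  by rewrite mulrA -rmorphM /b (mulrC (a j)) divfK.
rewrite !(bigD1_ord j) //= => E.
have {E} : \sum_i c (lift j i) *: iota (l (lift j i) - b i *: l j) = 0.
  rewrite -[RHS]E cj scaleNr scaler_suml addrC -sumrB; apply: eq_bigr => i _.
  by rewrite iotaD iotaN iotaZ; lmodring.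
move/IH => E; rewrite -[RHS]E cj.
have -> : tau (- \sum_i s (b i) * c (lift j i)) = - \sum_i s (b i) * tau (c (lift j i)).
  rewrite -mulN1r -(rmorph1 s) -rmorphN tauZ rmorphN rmorph1 mulN1r; congr (- _).
  by rewrite (big_morph tau tauD tau0); apply: eq_bigr => i _; rewrite tauZ.
rewrite scaleNr scaler_suml addrC -sumrB; apply: eq_bigr => i _.
by rewrite fD -scaleN1r fZ fZ rmorphN rmorph1; lmodring.
Qed.

Lemma extend : exists F : M -> W, forall t, F (comb t) = \sum_(p <- t) tau p.1 *: f p.2.
Proof.
have /choice [ch chE] := comb_ex.
exists (fun m => \sum_(p <- ch m) tau p.1 *: f p.2) => t.
have := chE (comb t); set t' := ch _ => E; apply/eqP; rewrite -subr_eq0; apply/eqP.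
pose r := t' ++ [seq (- p.1, p.2) | p <- t].
have r0 : \sum_(p <- r) p.1 *: iota p.2 = 0.
  rewrite big_cat big_map /= -[X in X + _ = _]/(comb t') -E.
  by under eq_bigr do rewrite scaleNr; rewrite sumrN subrr.
have : \sum_(p <- r) tau p.1 *: f p.2 = 0.
  by rewrite big_tnth; apply: (extend0 (l := fun i => (tnth (in_tuple r) i).2)); rewrite -[RHS]r0 [RHS]big_tnth.
rewrite big_cat big_map /= => E0; rewrite -[RHS]E0; congr (_ + _).
rewrite -sumrN; apply: eq_bigr => p _.
by rewrite -[- p.1]mulN1r -(rmorph1 s) -rmorphN tauZ rmorphN rmorph1 mulN1r scaleNr.
Qed.
End Extend.

(** [tau] is only [k]-linear: an automorphism of [k'] yields the Galois action on [M], the identity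
    yields the [k']-linear extension of a functional on [L]. *)
Lemma extend_semilinear (W : lmodType k') (tau : k' -> k') (f : L -> W) :
  (forall a c d, tau (s a * c + d) = s a * tau c + tau d) ->
  (forall a u v, f (a *: u + v) = s a *: f u + f v) ->
  exists F : M -> W, (forall u v, F (u + v) = F u + F v) /\
    (forall c l, F (c *: iota l) = tau c *: f l).
Proof.
move=> tauL fL; have [F FE] := extend tauL fL; exists F; split=> [u v|c l].
  have [t ->] := comb_ex u; have [t' ->] := comb_ex v.
  have -> : comb t + comb t' = comb (t ++ t') by rewrite /comb big_cat.
  by rewrite !FE big_cat.
by have := FE [:: (c, l)]; rewrite /comb !big_seq1.
Qed.

(* [F] is the action on [M] of the field automorphism [t]. *)
Definition semi (t : k' -> k') (F : M -> M) : Prop :=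
  [/\ forall u v, F (u + v) = F u + F v, forall c l, F (c *: iota l) = t c *: iota l & bijective F].

Lemma semi_ex (t : {rmorphism k' -> k'}) : gal s t -> exists F, semi t F.
Proof.
move=> [[t' Kt Kt'] ft].
have iL a u v : iota (a *: u + v) = s a *: iota u + iota v by apply: iotaL.
have [|F [FD FE]] := @extend_semilinear M t iota _ iL.
  by move=> a c d; rewrite rmorphD rmorphM ft.
have [|F' [FD' FE']] := @extend_semilinear M t' iota _ iL.
  by move=> a c d; apply: (can_inj Kt); rewrite Kt' rmorphD rmorphM ft !Kt'.
have K0 (G : M -> M) : (forall u v, G (u + v) = G u + G v) -> G 0 = 0.
  by move=> GD; have /(congr1 (fun z => z - G 0)) := GD 0 0; rewrite addr0 addrK subrr.
exists F; split=> //; exists F'; apply: iota_ind.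
- by rewrite !K0.
- by move=> u v Hu Hv; rewrite FD FD' Hu Hv.
- by move=> c l; rewrite FE FE' Kt.
- by rewrite !K0.
- by move=> u v Hu Hv; rewrite FD' FD Hu Hv.
- by move=> c l; rewrite FE' FE Kt'.
Qed.

Section Semi.
Variables (t : {rmorphism k' -> k'}) (F : M -> M).
Hypothesis sF : semi t F.
Lemma semiD u v : F (u + v) = F u + F v. Proof. by case: sF. Qed.
Lemma semi0 : F 0 = 0.
Proof. by have /(congr1 (fun z => z - F 0)) := semiD 0 0; rewrite addr0 addrK subrr. Qed.
Lemma semiZ c m : F (c *: m) = t c *: F m.
Proof.
move: m; apply: iota_ind => [|u v Hu Hv|d l]; first by rewrite scaler0 semi0 scaler0.
  by rewrite scalerDr !semiD Hu Hv scalerDr.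
by case: sF => _ FE _; rewrite scalerA !FE rmorphM scalerA.
Qed.
Lemma semiN m : F (- m) = - F m.
Proof. by rewrite -scaleN1r semiZ rmorphN rmorph1 scaleN1r. Qed.
Lemma semi_iota l : F (iota l) = iota l.
Proof. by case: sF => _ FE _; rewrite -[iota l]scale1r FE rmorph1. Qed.
Lemma semi_sum (I : Type) (r : seq I) (P : pred I) (G : I -> M) :
  F (\sum_(i <- r | P i) G i) = \sum_(i <- r | P i) F (G i).
Proof. exact: (big_morph F semiD semi0). Qed.
Lemma semi_comb r : F (comb r) = \sum_(p <- r) t p.1 *: iota p.2.
Proof. by rewrite /comb semi_sum; apply: eq_bigr => p _; rewrite semiZ semi_iota. Qed.
Hypothesis lieM : lie_algebra brM.
Lemma semi_br u v : F (brM u v) = brM (F u) (F v).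
Proof.
move: u v; apply: iota_ind => [v|u u' Hu Hu' v|c l].
- by rewrite semi0 !(br0l lieM) semi0.
- by rewrite semiD !(brDl lieM) semiD Hu Hu'.
apply: iota_ind => [|v v' Hv Hv'|d l'].
- by rewrite semi0 !(br0r lieM) semi0.
- by rewrite semiD !(brDr lieM) semiD Hv Hv'.
by rewrite !semiZ !(brZl lieM) !(brZr lieM) !semiZ !semi_iota -iota_br semi_iota.
Qed.
End Semi.

(** With [w] of trace 1, a fixed [m] is the sum of the conjugates of [w *: m]. Expanding [m] in
    vectors of [L] turns the coefficients into traces, which lie in [k]. *)
Lemma semi_fixed m : galois_ext s ->
  (forall (t : {rmorphism k' -> k'}) F, gal s t -> semi t F -> F m = m) -> exists u, m = iota u.
Proof.
move=> galois fixm; have [r mE] := comb_ex m.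
have [n [sg [w [gsg w1 perm]]]] := trace_one galois [seq p.1 | p <- r].
have /choice [F HF] : forall i, exists F, semi (sg i) F by move=> i; apply: semi_ex.
have /choice [a aE] : forall p, exists a, p \in r -> \sum_i sg i (w * p.1) = s a.
  move=> p; have [pr|npr] := boolP (p \in r); last by exists 0.
  have [|a aE] := @gal_fixed _ _ _ galois (\sum_i sg i (w * p.1)); last by exists a.
  move=> t gt; have [q qinj Hq] := perm t gt.
  rewrite rmorph_sum [RHS](reindex_inj qinj); apply: eq_bigr => i _.
  by rewrite !rmorphM (Hq i).1 (Hq i).2 // map_f.
exists (\sum_(p <- r) a p *: p.2); rewrite iota_sum.
have -> : m = \sum_i F i (w *: m).
  rewrite -[LHS]scale1r -w1 scaler_suml; apply: eq_bigr => i _.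
  by rewrite (semiZ (HF i)) (fixm _ _ (gsg i) (HF i)).
have -> : \sum_i F i (w *: m) = \sum_i \sum_(p <- r) sg i (w * p.1) *: iota p.2.
  apply: eq_bigr => i _; rewrite (semiZ (HF i)) mE (semi_comb (HF i)) scaler_sumr.
  by apply: eq_bigr => p _; rewrite scalerA rmorphM.
rewrite exchange_big /= big_seq [RHS]big_seq; apply: eq_bigr => p pr.
by rewrite -scaler_suml (aE p) // iotaZ.
Qed.

(** The functional of [z] is given as a bare function and must be linear to extend to [M]. As [z] is
    not a sandwich, some [brL z w0] is not a multiple of [z]; comparing its coefficients in the
    third identity yields linearity. *)
Lemma extremal_iota z : lie_algebra brL -> lie_algebra brM ->
  pure_extremal brL z -> extremal brM (iota z).
Proof.
move=> lieL lieM [[gz [z0 Ez]] nsand].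
have [w0 Hw0] : exists w, ~ exists c, brL z w = c *: z.
  apply: contrapT => H; apply: nsand => u w.
  have mult v : exists c, brL z v = c *: z.
    by apply: contrapT => nv; apply: H; exists v.
  have [c Hc] := mult u; have [d Hd] := mult w.
  rewrite Hc Hd (brZr lieL) (brvv lieL) scaler0 !(brZr lieL) (brC lieL u) Hc.
  by rewrite (brNr lieL) (brZr lieL) (brvv lieL) !(scaler0, oppr0).
have gzL a u v : gz (a *: u + v) = a * gz u + gz v.
  apply/eqP; rewrite -subr_eq0; apply: contrapT => /negP d0; apply: Hw0.
  have [_ _ E1] := Ez (a *: u + v) w0; have [_ _ E2] := Ez u w0; have [_ _ E3] := Ez v w0.
  have E : (gz (a *: u + v) - (a * gz u + gz v)) *: brL z w0 =
      (gz (brL (a *: u + v) w0) - (a * gz (brL u w0) + gz (brL v w0))) *: z.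
    move: E1; rewrite (br_linl lieL) (br_linr lieL) E2 E3 => E1.
    by apply: (eq_by_diff E1); rewrite (br_linr lieL); lmodring.
  set d := _ - _ in d0 E; exists (d^-1 * (gz (brL (a *: u + v) w0) - (a * gz (brL u w0) + gz (brL v w0)))).
  by apply: (scalerI d0); rewrite E scalerA mulVKf.
have [F [FD FZ]] : exists F : M -> k', (forall u v, F (u + v) = F u + F v) /\
    (forall c l, F (c *: iota l) = c * s (gz l)).
  apply: (@extend_semilinear k'^o idfun (fun u => s (gz u))) => // a u v.
  by rewrite gzL rmorphD rmorphM.
have F0 : F 0 = 0.
  by have /(congr1 (fun c => c - F 0)) := FD 0 0; rewrite addr0 addrK subrr.
exists F; split.
  apply: contra_neq z0 => z0; apply: iota_inj; rewrite z0 iota0 //.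
have brlin := (brDl lieM, brDr lieM, brZl lieM, brZr lieM, br0l lieM, br0r lieM).
have FiZ c d l l' : F (brM (c *: iota l) (d *: iota l')) = c * d * s (gz (brL l l')).
  by rewrite (brZl lieM) (brZr lieM) -iota_br scalerA FZ.
have id1 u : brM (iota z) (brM (iota z) u) = (F u *+ 2) *: iota z.
  move: u; apply: iota_ind => [|u v Hu Hv|c l].
  - by rewrite !brlin F0; lmodring.
  - by rewrite !brlin !FD Hu Hv; lmodring.
  by have [E _ _] := Ez l l; rewrite !brlin -!iota_br E iotaZ rmorphMn FZ; lmodring.
pose P u w := brM (brM (iota z) u) (brM (iota z) w) =
    F (brM u w) *: iota z + F w *: brM (iota z) u - F u *: brM (iota z) w /\
  brM (iota z) (brM u (brM (iota z) w)) =
    F (brM u w) *: iota z - F w *: brM (iota z) u - F u *: brM (iota z) w.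
suff PP u w : P u w by move=> u w; have [] := PP u w; split.
move: u w; apply: iota_ind => [w|u u' Hu Hu' w|c l].
- by rewrite /P !brlin F0; split; lmodring.
- have [a2 a3] := Hu w; have [b2 b3] := Hu' w; rewrite /P.
  by rewrite !brlin !FD; split; rewrite ?a2 ?a3 ?b2 ?b3; lmodring.
have [u uE] : exists u, u = c *: iota l by eexists.
rewrite -uE; apply: iota_ind => [|v v' [a2 a3] [b2 b3]|d l']; rewrite /P.
- by rewrite !brlin F0; split; lmodring.
- by rewrite !brlin !FD ?a2 ?a3 ?b2 ?b3; split; lmodring.
have [_ E2 E3] := Ez l l'; rewrite uE FiZ !FZ; split.
- by rewrite !brlin -!iota_br E2 !(iotaD, iotaN, iotaZ); lmodring.
- by rewrite !brlin -!iota_br E3 !(iotaD, iotaN, iotaZ); lmodring.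
Qed.

End ScalarExtension.

Lemma simple_center (R : fieldType) (V : lmodType R) (br : V -> V -> V) :
  lie_algebra br -> simple_lie br -> forall z, (forall u, br z u = 0) -> z = 0.
Proof.
move=> lieP [[a [b ab]] simple] z Hz.
pose Z z := forall u, br z u = 0.
have [|H|H] := simple Z; last by case/eqP: ab; apply: H.
  split=> [u|u v Hu Hv w|c u Hu w|u v Hv w]; first exact: (br0l lieP).
  - by rewrite (brDl lieP) Hu Hv addr0.
  - by rewrite (brZl lieP) Hu scaler0.
  - by rewrite (brC lieP u) Hv oppr0 (br0l lieP).
exact: H.
Qed.

(** * Descent of the exponential automorphisms *)

Section Descent.
Variables (k : fieldType) (L : lmodType k) (brL : L -> L -> L)
  (k' : fieldType) (s : {rmorphism k -> k'}) (M : lmodType k')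
  (brM : M -> M -> M) (iota : L -> M) (g : M -> M -> k') (x y : L).
Hypotheses (lieL : lie_algebra brL) (simpleL : simple_lie brL)
  (galois : galois_ext s) (large : not_F2 k')
  (SE : scalar_extension s brL brM iota)
  (lieM : lie_algebra brM) (simpleM : simple_lie brM)
  (genM : generated_by_pure_extremal brM) (linesM : contains_lines brM)
  (formg : extremal_form brM g)
  (pureX : pure_extremal brL x) (pureY : pure_extremal brL y)
  (gxy : g (iota x) (iota y) = 1).

Let formM : invariant_form brM g. Proof. by case: formg. Qed.
Let cM := simple_center lieM simpleM.
Let cL := simple_center lieL simpleL.
Let simp := simpleM.2.

Let ext_of z : extremal brM z -> ext brM g z.
Proof. by move=> Ez; case: formg => _ _ _ /(_ z Ez) [_ H] _. Qed.

Let nondeg v : (forall u, g v u = 0) -> v = 0.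
Proof.
move=> Hv; have [|H|H] := simp (I := fun v => forall u, g v u = 0).
- split=> [u|u w Hu Hw z|c u Hu z|u w Hw z]; first exact: (g0l formM).
  + by rewrite (gDl formM) Hu Hw addr0.
  + by rewrite (gZl formM) Hu mulr0.
  + by rewrite (brC lieM) (gNl formM) (gA formM) Hw oppr0.
- exact: H.
- by have := oner_neq0 k'; rewrite -gxy H eqxx.
Qed.

Let gen S : lie_subalgebra brM S -> (forall z, ext brM g z -> S z) -> forall v, S v.
Proof. by move=> HS ES; apply: genM => // z [/ext_of/ES]. Qed.

Let special : exists z w, [/\ ext brM g z, ext brM g w, g z w = 0 & brM z w != 0].
Proof.
have [a [b [[Ea _] [Eb _] nab ab comb]]] := linesM.
have a0 : a != 0 by case: Ea => ? [].
apply: (special_pair lieM formM cM nondeg gen ab) => p q.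
  have [->|q0] := eqVneq q 0.
    rewrite scale0r addr0 => /eqP; rewrite scaler_eq0 (negPf a0) orbF => /eqP ->.
    by [].
  move=> E; case: nab; exists (- (q^-1 * p)); apply: (scalerI q0).
  by rewrite scalerA mulrN mulVKf //; apply: (eq_by_diff E); lmodring.
by case: (comb p q) => [/ext_of//|->]; apply: ext0.
Qed.

Let X := iota x.
Let Y := iota y.
Let EX : ext brM g X. Proof. exact/ext_of/(extremal_iota SE lieL lieM). Qed.
Let EY : ext brM g Y. Proof. exact/ext_of/(extremal_iota SE lieL lieM). Qed.

Section Action.
Variables (t : {rmorphism k' -> k'}) (F : M -> M).
Hypotheses (gt : gal s t) (sF : semi iota t F).

Let F0 u : F u = 0 -> u = 0.
Proof. by case: (sF) => _ _ b Fu; apply: (bij_inj b); rewrite Fu (semi0 sF). Qed.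

(** Transport of structure makes [F z] extremal with the functional [t (g z (F' v))], and
    [ext_form_unique] identifies this with [g (F z)]. *)
Lemma semi_ext_g z : ext brM g z -> ext brM g (F z) /\ forall u, g (F z) (F u) = t (g z u).
Proof.
move=> Ez; have [->|z0] := eqVneq z 0.
  by rewrite (semi0 sF); split=> [|u]; [exact: ext0|rewrite !(g0l formM) rmorph0].
have [_ _ [F' K K']] := sF.
have Ew : extremal_with brM (fun v => t (g z (F' v))) (F z).
  split=> [|u w]; first by apply: contra_neq z0; apply: F0.
  have sbr := semi_br SE sF lieM; have [sD sN sZ] := And3 (semiD sF) (semiN SE sF) (semiZ SE sF).
  have e u' w' : F' (brM (F u') (F w')) = brM u' w' by rewrite -sbr K.
  rewrite -(K' u) -(K' w) e !K -!sbr; split.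
  - by rewrite (ext1 _ Ez) sZ rmorphMn.
  - by rewrite (ext2 _ _ Ez) !(sD, sN, sZ).
  - by rewrite (ext3 _ _ Ez) !(sD, sN, sZ).
have EF : ext brM g (F z) by apply: ext_of; eexists; exact: Ew.
split=> // u; rewrite -(ext_form_unique lieM formM cM simp nondeg gen special EF Ew.1 Ew (F u)).
by rewrite K.
Qed.

Lemma semi_ext z : ext brM g z -> ext brM g (F z).
Proof. by move=> /semi_ext_g []. Qed.

Lemma semi_g u v : g (F u) (F v) = t (g u v).
Proof.
apply: (span_ext lieM formM cM gen u (S := fun u => g (F u) (F v) = t (g u v))).
  split=> [|a w w' Hw Hw']; first by rewrite (semi0 sF) !(g0l formM) rmorph0.
  rewrite (semiD sF) (semiZ SE sF) !(gDl formM) !(gZl formM) Hw Hw'.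
  by rewrite rmorphD rmorphM.
by move=> z /semi_ext_g [].
Qed.

Lemma semi_expz z m : F (expz brM g z m) = expz brM g (F z) (F m).
Proof. by rewrite /expz !(semiD sF) (semiZ SE sF) (semi_br SE sF lieM) semi_g. Qed.

Lemma semi_prodexp r m : F (prodexp brM g r m) = prodexp brM g (map F r) (F m).
Proof. by elim: r => //= f r IH; rewrite semi_expz IH. Qed.

Lemma semi_gr1 f : grade brM g X Y 1 f -> grade brM g X Y 1 (F f).
Proof.
have FX : F X = X by apply: (semi_iota sF).
have FY : F Y = Y by apply: (semi_iota sF).
move=> [u [[a b c] ->]]; exists (F u); rewrite (semi_br SE sF lieM) FY; split=> //.
split.
- by rewrite -FX semi_g a rmorph0.
- by rewrite -FY semi_g b rmorph0.
- by rewrite -FX -FY -(semi_br SE sF lieM) semi_g c rmorph0.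
Qed.
End Action.

Lemma rational_form : exists gL : L -> L -> k, forall u v, g (iota u) (iota v) = s (gL u v).
Proof.
have /choice [f fE] : forall p : L * L, exists c, g (iota p.1) (iota p.2) = s c.
  move=> p; apply: (gal_fixed galois) => t gt; have [F sF] := semi_ex SE gt.
  by rewrite -(semi_g sF) !(semi_iota sF).
by exists (fun u v => f (u, v)) => u v; rewrite -fE.
Qed.

Lemma sum_of_extremal m : grade brM g X Y 1 m -> exists r : seq M,
  (forall f, f \in r -> grade brM g X Y 1 f /\ ext brM g f) /\ m = \sum_(f <- r) f.
Proof.
move=> Gm; pose P v := exists r : seq M,
  (forall f, f \in r -> grade brM g X Y 1 f /\ ext brM g f) /\ v = \sum_(f <- r) f.
apply: (gr1_span lieM formM cM simp nondeg gen special large EX EY gxy Gm (S := P)).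
  split=> [|a u v [r [Hr ->]] [r' [Hr' ->]]]; first by exists [::]; rewrite big_nil.
  exists ([seq a *: f | f <- r] ++ r'); split; last by rewrite big_cat big_map scaler_sumr.
  move=> f; rewrite mem_cat => /orP [/mapP [e er ->]|/Hr' //].
  by have [Ge Ee] := Hr e er; split; [apply: grZ|apply: extZ].
move=> f Hf; exists [:: f]; rewrite big_seq1; split=> // e.
by rewrite inE => /eqP ->.
Qed.

(** Each summand [e] is replaced by the conjugates of [w *: e], with [w] of trace 1. They add up to
    [iota l] because [iota l] is fixed, and a Galois automorphism permutes them for each [e]. *)
Lemma stable_sum l : grade brM g X Y 1 (iota l) -> exists r : seq M,
  [/\ forall f, f \in r -> grade brM g X Y 1 f /\ ext brM g f, iota l = \sum_(f <- r) f &
      forall (t : {rmorphism k' -> k'}) F, gal s t -> semi iota t F -> perm_eq (map F r) r].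
Proof.
move=> /sum_of_extremal [es [Hes lE]].
have /choice [c cE] := comb_ex SE.
(* The coefficients of all summands go into the finite set, so that the permutation of the [sg i]
   also governs the conjugates of the [e]. *)
have [n [sg [w [gsg w1 perm]]]] := trace_one galois (flatten [seq [seq p.1 | p <- c e] | e <- es]).
have /choice [F HF] : forall i, exists F, semi iota (sg i) F by move=> i; apply: (semi_ex SE).
pose conj e := [seq F i (w *: e) | i <- enum 'I_n].
exists (flatten [seq conj e | e <- es]); split.
- move=> f /flatten_mapP [e ees /mapP [i _ ->]]; have [Ge Ee] := Hes e ees.
  split; first by apply: (semi_gr1 (HF i)); apply: grZ.
  by apply: (semi_ext (HF i)); apply: extZ.
- rewrite big_flatten big_map /= lE -[LHS]scale1r -w1 scaler_suml.
  under [RHS]eq_bigr do rewrite big_map big_enum /=.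
  rewrite exchange_big /=; apply: eq_bigr => i _.
  rewrite -{1}lE -{1}(semi_iota (HF i) l) lE (semi_sum (HF i)) scaler_sumr.
  by apply: eq_bigr => e _; rewrite (semiZ SE (HF i)).
move=> t G gt sG; have [q qinj Hq] := perm t gt.
have H e : e \in es -> perm_eq (map G (conj e)) (conj e).
  move=> ees; have -> : map G (conj e) = [seq F i (w *: e) | i <- map q (enum 'I_n)].
    rewrite /conj -!map_comp; apply: eq_map => i /=.
    have we : w *: e = comb iota [seq (w * p.1, p.2) | p <- c e].
      rewrite {1}(cE e) /comb big_map scaler_sumr.
      by apply: eq_bigr => p _; rewrite scalerA.
    rewrite we !(semi_comb SE (HF _)) !big_map /= (semi_sum sG) big_seq [RHS]big_seq.
    apply: eq_bigr => p pc; have [_ GE _] := sG; rewrite GE !rmorphM (Hq i).1 (Hq i).2 //.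
    by apply/flatten_mapP; exists e => //; apply: map_f.
  apply: perm_map; apply: uniq_perm; first by rewrite map_inj_uniq ?enum_uniq.
    exact: enum_uniq.
  move=> i; rewrite mem_enum; have [q' K K'] := injF_bij qinj.
  by rewrite -(K' i) map_f // mem_enum.
rewrite map_flatten -map_comp.
elim: {lE Hes c cE perm Hq} es H => //= e es IH H.
apply: perm_cat; first by apply: H; rewrite mem_head.
by apply: IH => e' e'es; apply: H; rewrite in_cons e'es orbT.
Qed.

Section RationalForm.
Variable gL : L -> L -> k.
Hypothesis gLE : forall u v, g (iota u) (iota v) = s (gL u v).

Let sinj : injective s. Proof. exact: fmorph_inj. Qed.

Lemma rational_invariant : invariant_form brL gL.
Proof.
split=> [u v|a u v w|a b c]; apply: sinj.
- by rewrite -!gLE (gC formM).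
- by rewrite rmorphD rmorphM -!gLE (iotaL SE) (gDl formM) (gZl formM).
- by rewrite -!gLE !(iota_br SE) (gA formM).
Qed.
Let formL := rational_invariant.

Lemma rational_ext z : ext brM g (iota z) -> ext brL gL z.
Proof.
move=> Ez u w; have iE := (iotaD SE, iotaN SE, iotaZ SE, iota_br SE).
split; apply: (iota_inj SE); rewrite !iE.
- by rewrite (ext1 _ Ez) gLE rmorphMn.
- by rewrite (ext2 _ _ Ez) -!gLE (iota_br SE).
- by rewrite (ext3 _ _ Ez) -!gLE (iota_br SE).
Qed.

Let ELx : ext brL gL x. Proof. exact: rational_ext EX. Qed.
Let ELy : ext brL gL y. Proof. exact: rational_ext EY. Qed.
Let gLxy : gL x y = 1. Proof. by apply: sinj; rewrite -gLE rmorph1. Qed.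

Lemma iota_pr i m : iota (pr brL gL x y i m) = pr brM g X Y i (iota m).
Proof.
have iE := (iotaD SE, iotaN SE, iotaZ SE, iota_br SE).
rewrite !prT; case: i => [[|[|[|n]]]|[|[|n]]] /=; rewrite /pdn ?iE -?gLE ?iE ?rmorphMn -?gLE //;
  exact: (iota0 SE).
Qed.

Lemma iota_grade i m : grade brL gL x y i m -> grade brM g X Y i (iota m).
Proof.
move=> /(pr_id lieL formL cL ELx ELy gLxy) <-; rewrite iota_pr.
exact: (gr_pr lieM formM cM EX EY gxy).
Qed.

Lemma iota_Fil n m : Fil brL gL x y n m <-> Fil brM g X Y n (iota m).
Proof.
split=> F i lt; first by rewrite -iota_pr F // (iota0 SE).
by apply: (iota_inj SE); rewrite iota_pr F // (iota0 SE).
Qed.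

Lemma grade_rational i m :
  grade brL (fun a b => g (iota a) (iota b)) x y i m <-> grade brL gL x y i m.
Proof.
have U u : U_space brL (fun a b => g (iota a) (iota b)) x y u <-> U_space brL gL x y u.
  rewrite /U_space !gLE.
  split=> [[a b c]|[-> -> ->]]; last by rewrite rmorph0.
  by split; apply: sinj; rewrite rmorph0.
case: i => [[|[|[|n]]]|[|[|n]]] //=; split=> -[u [/U Uu ->]]; by exists u.
Qed.

(** [expz (c *: Y)] sends [iota m0] to [iota m0 + c *: Y], so [c] can be read off by pairing with
    [X]. Taking [m0] in [L] makes this reading compatible with the Galois action. *)
Lemma rational_dual_h : exists m0, grade brL gL x y 0 m0 /\ g (brM X Y) (iota m0) = 1.
Proof.
have Y0 : Y != 0.
  by apply/eqP => Y0; have := oner_neq0 k'; rewrite -gxy -/Y Y0 (g0r formM) eqxx.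
have [f nf] := nbr_ex lieM formM cM simp nondeg gen special EY Y0.
have [b [_ [_ Gb b0 _]]] := nbr_frame lieM formM cM EX EY gxy nf.
have [n [_ gn]] := dual_h lieM formM cM nondeg EX EY gxy Gb b0.
have [m gm] : exists m, gL (brL x y) m != 0.
  apply: contrapT => H; have := oner_neq0 k'; rewrite -gn => /eqP; apply.
  move: n {gn}; apply: (iota_ind SE) => [|u v Hu Hv|c l].
  - exact: (g0r formM).
  - by rewrite (gDr formM) Hu Hv addr0.
  rewrite (gZr formM) -(iota_br SE) gLE.
  have [->|n0] := eqVneq (gL (brL x y) l) 0; first by rewrite rmorph0 mulr0.
  by case: H; exists l.
have Gh := gr_h lieL formL ELx ELy gLxy.
exists ((gL (brL x y) m)^-1 *: pr brL gL x y 0 m); split.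
  exact/(grZ lieL formL)/(gr_pr lieL formL cL ELx ELy gLxy).
rewrite -(iota_br SE) gLE -(rmorph1 s); congr (s _).
rewrite (gZr formL) (gC formL _ (pr _ _ _ _ _ _)).
have <- : gL m (brL x y) = gL (pr brL gL x y 0 m) (brL x y).
  exact: (g_pr lieL formL cL ELx ELy gLxy m Gh).
by rewrite (gC formL m) mulVf.
Qed.

(* Products of exponentials over a Galois-stable family are determined up to a
   factor [expz (c *: Y)]; prescribing the [X]-component of the image of [m0]
   fixes this factor, which makes the product commute with the Galois group. *)
Lemma galois_exponential l : grade brM g X Y 1 (iota l) -> exists be,
  [/\ isom brM g be, expo brM g X Y (iota l) be &
      forall (t : {rmorphism k' -> k'}) F, gal s t -> semi iota t F ->
        forall m, F (be m) = be (F m)].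
Proof.
move=> /[dup] Gl /stable_sum [r [Hr lE Hperm]].
have [m0 [Gm0 gm0]] := rational_dual_h.
have GM0 := iota_grade Gm0.
have Er f : f \in r -> ext brM g f by move=> /Hr [].
have Gr f : f \in r -> grade brM g X Y 1 f by move=> /Hr [].
have Ir := prodexp_isom lieM formM cM Er.
pose N al := g X (al (iota m0)).
have EYc c : ext brM g (c *: Y) by apply: extZ.
have NE c : N (prodexp brM g r \o expz brM g (c *: Y)) = N (prodexp brM g r) + c.
  have e1 : expz brM g (c *: Y) (iota m0) = iota m0 + c *: Y.
    rewrite /expz (brZl lieM) (br_y_gr0 formM gxy GM0) gm0 scale1r (gZl formM).
    by rewrite (g_orth lieM formM cM EX EY gxy (gr_y brM g X Y) GM0) // mulr0 scale0r addr0.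
  have PY : prodexp brM g r Y = Y.
    elim: (r) Gr => //= f r' IH G; rewrite IH; last by move=> e er; apply: G; rewrite in_cons er orbT.
    by apply: (expz_fix_y lieM formM cM EX EY gxy); apply: G; rewrite mem_head.
  by rewrite /N /= e1 (isomD Ir) (isomZ Ir) PY (gDr formM) (gZr formM) gxy mulr1.
pose c0 := - N (prodexp brM g r).
exists (prodexp brM g r \o expz brM g (c0 *: Y)); split.
- exact: (isom_comp Ir (expz_isom lieM formM cM (EYc c0))).
- apply: (expo_y lieM formM cM EX EY gxy) => //; rewrite lE.
  exact: (expo_prodexp lieM formM cM EX EY gxy).
move=> t F gt sF.
have FX : F X = X by apply: (semi_iota sF).
have FY : F Y = Y by apply: (semi_iota sF).
have HFr f : f \in map F r -> grade brM g X Y 1 f /\ ext brM g f.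
  by move=> /mapP [e /Hr [Ge Ee] ->]; split; [apply: (semi_gr1 sF)|apply: (semi_ext sF)].
have [c cE] := prodexp_perm lieM formM cM EX EY gxy HFr (Hperm t F gt sF).
have E m : F (prodexp brM g r (expz brM g (c0 *: Y) m)) =
    prodexp brM g r (expz brM g ((c + t c0) *: Y) (F m)).
  rewrite (semi_prodexp sF) cE (semi_expz sF) (semiZ SE sF) FY.
  by rewrite (expzD lieM formM cM EY).
suff cc : c + t c0 = c0 by move=> m /=; rewrite E cc.
(* Pairing with [X] gives [t 0 = 0] on the left, by the choice of [c0], and [c + t c0 - c0] on the
   right. *)
have := congr1 (g X) (E (iota m0)); rewrite (semi_iota sF) -{1}FX (semi_g sF).
rewrite [g X (prodexp _ _ _ _)](NE c0) addrN rmorph0 [RHS](NE (c + t c0)) => /esym/eqP.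
by rewrite addrC addr_eq0 => /eqP.
Qed.

(** [be] and its inverse commute with the Galois action, so both map fixed vectors to fixed vectors
    and restrict to [L]. *)
Lemma rational_exponential l : grade brL gL x y 1 l -> exists al : L -> L,
  lie_automorphism brL al /\ expo brL gL x y l al.
Proof.
move=> /iota_grade/galois_exponential [be [Ib expb comm]].
have [_ [be' K K'] _ _] := Ib.
have Ib' := isom_inv Ib K K'.
have /choice [al alE] : forall u, exists v, be (iota u) = iota v.
  move=> u; apply: (semi_fixed SE galois) => t F gt sF.
  by rewrite (comm t F gt sF) (semi_iota sF).
have /choice [al' alE'] : forall u, exists v, be' (iota u) = iota v.
  move=> u; apply: (semi_fixed SE galois) => t F gt sF.
  by apply: (can_inj K); rewrite -(comm t F gt sF) !K' (semi_iota sF).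
exists al; split; last first.
  move=> n m /iota_Fil Fm; apply/iota_Fil.
  by rewrite !(iotaD SE, iotaN SE) (iota_br SE) -alE; apply: expb.
split=> [a u v||u v].
- by apply: (iota_inj SE); rewrite -alE !(iotaL SE) (isomD Ib) (isomZ Ib) !alE.
- by exists al' => u; apply: (iota_inj SE); rewrite -?alE' -?alE -?alE' ?K ?K'.
- by apply: (iota_inj SE); rewrite -alE !(iota_br SE) -!alE; case: Ib.
Qed.

End RationalForm.

Lemma algebraic_of_descent : algebraic_grading brL (fun a b => g (iota a) (iota b)) x y.
Proof.
have [gL gLE] := rational_form.
have formL := rational_invariant gLE.
have ELx : ext brL gL x by apply: (rational_ext gLE EX).
have ELy : ext brL gL y by apply: (rational_ext gLE EY).
have gLxy : gL x y = 1 by apply: (fmorph_inj s); rewrite -gLE rmorph1.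
move=> l /(grade_rational gLE) Gl; have [al [aut ex]] := rational_exponential gLE Gl.
have [lin _ _] := aut.
have [q [n [v [Hq Hn Hv E]]]] := expo_grade lieL formL cL ELx ELy gLxy lin Gl ex.
exists al; split=> //; exists q, n, v; split=> // i m _ /(grade_rational gLE) Gm;
  by apply/(grade_rational gLE); auto.
Qed.

End Descent.

Theorem theorem3p16 (k : fieldType) (L : lmodType k) (brL : L -> L -> L)
  (k' : fieldType) (s : {rmorphism k -> k'}) (M : lmodType k')
  (brM : M -> M -> M) (iota : L -> M) (g : M -> M -> k') (x y : L) :
  lie_algebra brL -> simple_lie brL ->
  galois_ext s -> not_F2 k' ->
  scalar_extension s brL brM iota ->
  lie_algebra brM -> simple_lie brM ->
  generated_by_pure_extremal brM -> contains_lines brM ->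
  extremal_form brM g ->
  hyperbolic_pair brL (fun a b => g (iota a) (iota b)) x y ->
  g (iota x) (iota y) = 1 ->
  algebraic_grading brL (fun a b => g (iota a) (iota b)) x y.
Proof.
move=> lieL simpleL galois large SE lieM simpleM genM lines form [pX pY _ _] gxy.
exact: (algebraic_of_descent lieL simpleL galois large SE lieM simpleM genM lines form pX pY gxy).
Qed.
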